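(* The real flow given by the translation $\sigma$ (acting coordinatewise) on the product space $$\prod_{m=0}^{+\infty}\prod_{n=0}^m\mathcal{B}\left([-n/3-1/2,-n/3]\cup[n/3,n/3+1/2]\right)$$ is universal; that is, every real flow $(X,\mathbb{R},T)$ can be embedded in it.
   Context: A real flow $(X,\mathbb{R},T)$ is a compact metric space $X$ with a continuous map $T:\mathbb{R}\times X\to X$, $(t,x)\mapsto T_tx$, with $T_0x=x$ and $T_{r+s}x=T_rT_sx$. A flow $(Y,\mathbb{R},S)$ can be embedded in $(X,\mathbb{R},T)$ if there is a homeomorphism $\phi$ of $Y$ into $X$ (onto its image) with $\phi(S_ty)=T_t\phi(y)$ for all $t\in\mathbb{R}$, $y\in Y$. A real flow is universal if all real flows can be embedded in it. Function spaces on $\mathbb{R}$ carry the topology of uniform convergence on compact subsets, given by $D(f,g)=\sum_{n\ge1}2^{-n}\|f-g\|_{L^\infty([-n,n])}$. The translation is $\sigma_t f=f(\cdot+t)$. Products carry the product topology, and $\mathbb{R}$ acts on them by translating every coordinate. For compact $I\subset\mathbb{R}$, a bounded continuous $f:\mathbb{R}\to\mathbb{C}$ is band-limited in $I$ if $\mathrm{supp}(\mathcal{F}(f))\subset I$, where $\mathcal{F}(f)$ is the Fourier transform of $f$ as a tempered distribution (extending $\mathcal{F}(f)(\xi)=\int_{\mathbb{R}}e^{-2\pi\sqrt{-1}t\xi}f(t)\,dt$); i.e. $\langle\mathcal{F}(f),g\rangle=0$ for all rapidly decreasing (Schwartz) $g:\mathbb{R}\to\mathbb{C}$ with $\mathrm{supp}(g)\cap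 I=\emptyset$. $\mathcal{B}(I)$ is the set of continuous $f:\mathbb{R}\to\mathbb{R}$ band-limited in $I$ with $\|f\|_{L^\infty(\mathbb{R})}\le1$; it is compact and translation invariant. *)

(* Defs.v *)
From mathcomp Require Import all_boot all_order all_algebra.
From mathcomp Require Import complex.
From mathcomp Require Import all_classical all_reals all_analysis.

Set Implicit Arguments.
Unset Strict Implicit.
Unset Printing Implicit Defensive.

Import Order.TTheory GRing.Theory Num.Theory.
Import numFieldTopology.Exports numFieldNormedType.Exports.

Local Open Scope classical_set_scope.
Local Open Scope ring_scope.
Local Open Scope complex_scope.

(** ** Real flows *)

Section Flows.
Variable R : realType.

(* The metric of a flow plays no role beyond the topology it induces (flow maps
   and embeddings are only required to be continuous), so a compact metric space
   is rendered as a compact topological space whose topology is induced by some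
   metric. *)
Definition metric_for (X : topologicalType) (d : X -> X -> R) : Prop :=
  [/\ forall x y, 0 <= d x y /\ (d x y = 0 <-> x = y),
      forall x y, d x y = d y x,
      forall x y z, d x z <= d x y + d y z &
      forall (x : X) (U : set X),
        nbhs x U <-> exists2 e : R, 0 < e & [set y | d x y < e] `<=` U].

Definition metrizable (X : topologicalType) : Prop :=
  exists d : X -> X -> R, metric_for d.

Record real_flow (X : topologicalType) (T : R -> X -> X) : Prop := RealFlow {
  real_flow_compact : compact [set: X];
  real_flow_metrizable : metrizable X;
  real_flow_continuous : continuous (fun p : R * X => T p.1 p.2);
  real_flow0 : forall x, T 0 x = x;
  real_flowD : forall r s x, T (r + s) x = T r (T s x)
}.

Definition homeomorphism_onto_image (Y X : topologicalType) (phi : Y -> X) :=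
  [/\ injective phi, continuous phi &
      forall U : set Y, open U ->
        exists2 V : set X, open V & phi @` U = V `&` range phi].

Definition embeds (Y X : topologicalType)
    (S : R -> Y -> Y) (T : R -> X -> X) : Prop :=
  exists2 phi : Y -> X, homeomorphism_onto_image phi &
    forall t y, phi (S t y) = T t (phi y).

Definition universal_flow (X : topologicalType) (T : R -> X -> X) : Prop :=
  real_flow T /\
  forall (Y : topologicalType) (S : R -> Y -> Y), real_flow S -> embeds S T.

End Flows.

(** ** Band-limited functions *)

Section BandLimited.
Variable R : realType.
Local Notation mu := (@lebesgue_measure R).
Local Notation Re := complex.Re.
Local Notation Im := complex.Im.

Definition cintegral (f : R -> R[i]) : R[i] :=
  (\int[mu]_x Re (f x)) +i* (\int[mu]_x Im (f x)).

Definition expi (x : R) : R[i] := cos x +i* sin x.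

Definition fourier (g : R -> R[i]) (t : R) : R[i] :=
  cintegral (fun xi => expi (- (2 * pi * t * xi)) * g xi).

Definition schwartz_real (f : R -> R) : Prop :=
  (forall (n : nat) (x : R), derivable (derive1n n f) x 1) /\
  (forall k n : nat, exists C : R,
     forall x : R, `|x ^+ k * derive1n n f x| <= C).

(* A derivative of a complex-valued function of a real variable is taken on real
   and imaginary parts. *)
Definition schwartz (g : R -> R[i]) : Prop :=
  schwartz_real (fun x => Re (g x)) /\ schwartz_real (fun x => Im (g x)).

Definition fsupport (g : R -> R[i]) : set R := closure [set x | g x != 0].

(* The pairing <F(f), g> of the distributional Fourier transform of f with a
   Schwartz function g, which by definition is <f, F(g)>; it is bilinear: there
   is no complex conjugation. *)
Definition fourier_pairing (f g : R -> R[i]) : R[i] :=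
  cintegral (fun t => f t * fourier g t).

Definition band_limited (I : set R) (f : R -> R[i]) : Prop :=
  [/\ continuous (fun t => Re (f t)), continuous (fun t => Im (f t)),
      exists M : R, forall t, `|f t| <= M%:C &
      forall g : R -> R[i], schwartz g -> fsupport g `&` I = set0 ->
        fourier_pairing f g = 0].

(* The ambient space carries the topology of uniform convergence on compact
   sets.  As f is continuous, its L^oo norm is the supremum of |f|. *)
Definition band_space (I : set R) : set {family compact, R -> R} :=
  [set f : R -> R |
    band_limited I (fun t => (f t)%:C) /\ forall t, `|f t| <= 1].

Definition translate (t : R) (f : R -> R) : R -> R := fun s => f (s + t).

Definition band (n : nat) : set R :=
  `[- (n%:R / 3) - 1 / 2, - (n%:R / 3)] `|` `[n%:R / 3, n%:R / 3 + 1 / 2].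

(* Each factor is the type of elements of a set, with the subspace topology;
   prod_topology carries the product topology. *)
Definition band_product : topologicalType :=
  prod_topology (fun m : nat =>
    prod_topology (fun n : 'I_m.+1 => set_type (band_space (band n)))).

End BandLimited.

(* Main.v *)
(** Every point of a flow [Y] is recorded through the orbit functions
    [t |-> h (S_t y)], where [h] ranges over a countable family of observables
    separating points.  Convolving an orbit function with
    [cos (2 k x) * sin^2 x / x^2] confines its spectrum to the two intervals of
    length 1/3 centred at [k / 6] and [- k / 6], and these lie in the band of
    index [(k - 1) / 2].  No information is lost: by the Fejer identity the
    dilated kernels [sin^2 (M x) / x^2] are combinations of these, and they form
    an approximate identity.

    The product is compact because a band-limited function is reproduced by
    integration against translates of a fixed integrable kernel, the Fourier
    transform of a smooth plateau, which makes every factor equicontinuous.  The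
    Fourier integrals needed are elementary: [int (1 - cos (b x)) / x^2] is
    [|b|] times a positive constant by scaling, hence the transform of
    [sin^2 x / x^2] is, up to that constant, a tent function. *)
Require Import Defs.
From mathcomp Require Import all_boot all_order all_algebra.
From mathcomp Require Import complex ring lra zify.
From mathcomp Require Import all_classical all_reals all_analysis.
From mathcomp Require Import measurable_realfun.

Set Implicit Arguments.
Unset Strict Implicit.
Unset Printing Implicit Defensive.

Import Order.TTheory GRing.Theory Num.Theory.
Import numFieldTopology.Exports numFieldNormedType.Exports.

Local Open Scope classical_set_scope.
Local Open Scope ring_scope.

(** * Lebesgue integrals on the line *)


Section Integration.
Variable R : realType.
Implicit Types f g : R -> R.
Local Notation mu := (@lebesgue_measure R).

(** The bands have length 1/2, not 1/3, because neighbouring modulated kernels must overlap. The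
    Fejer identity uses the frequencies [2 k], whose spacing is half the width 4 of the tent. After
    rescaling, the spectral intervals have length 1/3 and centres 1/6 apart, so [k = 2 n + 1] and
    [k = 2 n + 2] together fill the band of index [n], while [k = 0] falls into the band of index 0.
    The band of index [n] recurs in every row [m >= n]. This leaves room to give each row a single
    pair of an observable and a frequency and to put 0 in its other factors. Fourier inversion is
    avoided. Spectra enter only through pairings with transforms of test functions, and the
    identities come from Fubini with explicit kernels, dilation and dominated convergence. Complex
    exponentials are replaced by cosines with a free phase, which keeps all integrals real. The
    product topology is controlled by evaluations at rational times: they are countably many,
    continuous and separate points, which yields the Hausdorff property and, with compactness, a
    metric. *)

Definition L1 (f : R -> R) : Prop := mu.-integrable [set: R] (EFin \o f).

Lemma L1_measurable f : L1 f -> measurable_fun [set: R] f.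
Proof. by case/integrableP => /measurable_EFinP. Qed.

Lemma L1_dominated f g : measurable_fun [set: R] f -> L1 g ->
  (forall x, `|f x| <= g x) -> L1 f.
Proof.
move=> mf ig fg; apply: (le_integrable _ _ _ ig) => //.
  exact/measurable_EFinP.
by move=> x _ /=; rewrite lee_fin (le_trans (fg x))// ler_norm.
Qed.

Lemma L1Z (k : R) f : L1 f -> L1 (fun x => k * f x).
Proof. by move=> /(integrableZl measurableT k). Qed.

Lemma L1D f g : L1 f -> L1 g -> L1 (fun x => f x + g x).
Proof. by move=> lf lg; exact: (integrableD measurableT lf lg). Qed.

Lemma L1B f g : L1 f -> L1 g -> L1 (fun x => f x - g x).
Proof. by move=> lf lg; exact: (integrableB measurableT lf lg). Qed.

Lemma L1_norm f : L1 f -> L1 (fun x => `|f x|).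
Proof. exact: integrable_norm. Qed.

Lemma L1M_bounded M f g : measurable_fun [set: R] f -> (forall x, `|f x| <= M) ->
  L1 g -> L1 (fun x => f x * g x).
Proof.
move=> mf fM lg; apply: (@L1_dominated _ (fun x => M * `|g x|)).
- by apply: measurable_funM => //; exact: L1_measurable.
- exact/L1Z/L1_norm.
- by move=> x; rewrite normrM ler_wpM2r.
Qed.

Lemma RintZ (k : R) f : L1 f ->
  \int[mu]_x (k * f x) = k * \int[mu]_x f x.
Proof. exact: RintegralZl. Qed.

Lemma RintD f g : L1 f -> L1 g ->
  \int[mu]_x (f x + g x) = \int[mu]_x f x + \int[mu]_x g x.
Proof. exact: RintegralD. Qed.

Lemma RintB f g : L1 f -> L1 g ->
  \int[mu]_x (f x - g x) = \int[mu]_x f x - \int[mu]_x g x.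
Proof. exact: RintegralB. Qed.

Lemma eq_Rint f g : f =1 g -> \int[mu]_x f x = \int[mu]_x g x.
Proof. by move=> fg; apply: eq_Rintegral => x _; exact: fg. Qed.

Lemma Rint_norm_le f g : measurable_fun [set: R] f -> L1 g ->
  (forall x, `|f x| <= g x) -> `|\int[mu]_x f x| <= \int[mu]_x g x.
Proof.
move=> mf lg fg; have lf := L1_dominated mf lg fg.
apply: (le_trans (le_normr_Rintegral measurableT lf)).
by apply: le_Rintegral => //; exact: L1_norm.
Qed.

Lemma Rint_zero : \int[mu]_x (0 : R) = 0.
Proof. by rewrite Rintegral_cst// mul0r. Qed.

Lemma L1_oneDsqrV : L1 (fun x => (1 + x ^+ 2)^-1).
Proof.
have c1 : continuous (fun x : R => (1 + x ^+ 2)^-1).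
  exact: continuous_oneDsqrV.
have p1 (x : R) : 0 <= (1 + x ^+ 2)^-1.
  by rewrite invr_ge0 addr_ge0// sqr_ge0.
apply/integrableP; split.
  by apply/measurable_EFinP; exact: continuous_measurable_fun.
under eq_integral => x _ do rewrite /= ger0_norm//.
rewrite ge0_symfun_integralT//; last by move=> x /=; rewrite sqrrN.
have -> : [set x : R | 0 <= x] = `[0, +oo[%classic.
  by apply/seteqP; split => x /=; rewrite in_itv/= andbT.
rewrite (_ : (\int[_]_(x in _) _)%E = (pi / 2)%:E); last exact: integral0y_oneDsqr.
by rewrite -EFinM ltry.
Qed.

Lemma measurable_affine (a b : R) : measurable_fun [set: R] (fun x => a * x + b).
Proof.
apply: measurable_funD => //; exact: measurable_funM.
Qed.

(** The image of Lebesgue measure under the affine map, scaled by [a], agrees with Lebesgue measure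
    on half-open intervals, and these determine it. *)
Lemma ge0_integral_affine (a b : R) (f : R -> \bar R) : 0 < a ->
  measurable_fun [set: R] f -> (forall x, (0 <= f x)%E) ->
  (\int[mu]_x f x = a%:E * \int[mu]_x f (a * x + b)%R)%E.
Proof.
move=> a0 mf f0.
pose phi : R -> measurableTypeR R := fun x => a * x + b.
have mphi : measurable_fun [set: R] phi by exact: measurable_affine.
have muE (A : set R) : measurable A ->
    mu A = mscale (NngNum (ltW a0)) (pushforward mu phi) A.
  apply: lebesgue_measure_unique => //= _ [[c d]] _ <-.
  rewrite /mscale/= /pushforward.
  have -> : phi @^-1` `]c, d] = `](c - b) / a, (d - b) / a]%classic.
    apply/seteqP; split => x /=; rewrite !in_itv/= ltr_pdivrMr// ler_pdivlMr//;
    by rewrite /phi ltrBlDr lerBrDr mulrC.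
  rewrite !lebesgue_measure_itv/= !lte_fin ltr_pM2r ?invr_gt0// ltrD2r.
  case: ifP => _; last by rewrite mule0.
  rewrite -!EFinB -EFinM -mulrBl mulrC divfK ?gt_eqF//.
  by congr EFin; ring.
rewrite (eq_measure_integral (mscale (NngNum (ltW a0)) (pushforward mu phi))).
  rewrite ge0_integral_mscale//=; congr (_ * _)%E.
  by rewrite ge0_integral_pushforward.
by move=> A mA _; exact: muE.
Qed.

Lemma L1_affine (a b : R) f : 0 < a -> L1 f -> L1 (fun x => f (a * x + b)).
Proof.
move=> a0 lf; apply/integrableP; split.
  apply/measurable_EFinP; apply: (measurableT_comp (L1_measurable lf)).
  exact: measurable_affine.
have /integrableP[mf] := lf.
rewrite (@ge0_integral_affine a b _ a0)//; last exact: measurableT_comp.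
have : (0 <= \int[mu]_x `|(EFin \o f) (a * x + b)%R|)%E by exact: integral_ge0.
rewrite /=; case: (integral _ _ _) => [r| |] //= _; first by move=> _; exact: ltry.
by rewrite mulry gtr0_sg// mul1e.
Qed.

Lemma Rint_affine (a b : R) f : 0 < a -> L1 f ->
  \int[mu]_x f (a * x + b) = a^-1 * \int[mu]_x f x.
Proof.
move=> a0 lf; apply: (canRL (mulKf _)); first by rewrite gt_eqF.
have lfa := L1_affine b a0 lf.
rewrite /Rintegral.
have mf : measurable_fun [set: R] (EFin \o f) by case/integrableP: lf.
have Ep : (\int[mu]_x (EFin \o f)^\+ x = a%:E *
    \int[mu]_x (EFin \o (fun x => f (a * x + b)%R))^\+ x)%E.
  rewrite (@ge0_integral_affine a b _ a0)//; last exact: measurable_funepos.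
  by congr (_ * _)%E; apply: eq_integral => x _; rewrite !unlock.
have En : (\int[mu]_x (EFin \o f)^\- x = a%:E *
    \int[mu]_x (EFin \o (fun x => f (a * x + b)%R))^\- x)%E.
  rewrite (@ge0_integral_affine a b _ a0)//; last exact: measurable_funeneg.
  by congr (_ * _)%E; apply: eq_integral => x _; rewrite !unlock.
change (a * fine (\int[mu]_x (EFin \o (fun x => f (a * x + b)%R)) x)%E =
  fine (\int[mu]_x (EFin \o f) x)%E).
rewrite [in RHS]integralE [in LHS]integralE Ep En.
have := integrable_neg_fin_num measurableT lfa.
have := integrable_pos_fin_num measurableT lfa.
case: (\int[mu]_x _^\+%E x)%E => //= r _.
case: (\int[mu]_x _^\-%E x)%E => //= s _.
by rewrite mulrBr.
Qed.

Lemma L1_shift b f : L1 f -> L1 (fun x => f (x + b)).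
Proof.
move=> /(L1_affine b ltr01).
by congr L1; apply/funext => x; rewrite mul1r.
Qed.

Lemma Rint_shift b f : L1 f -> \int[mu]_x f (x + b) = \int[mu]_x f x.
Proof.
move=> /(Rint_affine b ltr01); rewrite invr1 mul1r => <-.
by apply: eq_Rint => x; rewrite mul1r.
Qed.

Lemma L1_scale a f : 0 < a -> L1 f -> L1 (fun x => f (a * x)).
Proof.
move=> a0 /(L1_affine 0 a0).
by congr L1; apply/funext => x; rewrite addr0.
Qed.

Lemma Rint_scale a f : 0 < a -> L1 f ->
  \int[mu]_x f (a * x) = a^-1 * \int[mu]_x f x.
Proof.
by move=> a0 /(Rint_affine 0 a0) <-; apply: eq_Rint => x; rewrite addr0.
Qed.

Lemma ge0_integral_opp (f : R -> \bar R) :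
  measurable_fun [set: R] f -> (forall x, (0 <= f x)%E) ->
  (\int[mu]_x f x = \int[mu]_x f (- x)%R)%E.
Proof.
move=> mf f0.
rewrite (eq_measure_integral
    (pushforward mu (-%R : R -> measurableTypeR R))).
  by rewrite ge0_integral_pushforward.
by move=> A mA _; exact/esym/lebesgue_measureN.
Qed.

Lemma Rint_odd f : measurable_fun [set: R] f -> (forall x, f (- x) = - f x) ->
  \int[mu]_x f x = 0.
Proof.
move=> mf fN; rewrite /Rintegral integralE.
have mf' : measurable_fun [set: R] (EFin \o f) by exact/measurable_EFinP.
rewrite [X in (_ - X)%E]ge0_integral_opp//; last exact: measurable_funeneg.
rewrite [X in (_ - X)%E](_ : _ = \int[mu]_x (EFin \o f)^\+%E x)%E.
  have : (0 <= \int[mu]_x (EFin \o f)^\+%E x)%E by exact: integral_ge0.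
  (* If both parts have infinite integral, their extended difference is infinite and [fine] sends it
     to 0. *)
  by case: (integral _ _ _) => //= r _; rewrite subrr.
by apply: eq_integral => x _; rewrite !unlock/= fN opprK.
Qed.

Lemma Rint_dominated_cvg (f_ : nat -> R -> R) f g :
  (forall n, measurable_fun [set: R] (f_ n)) ->
  (forall x, f_ n x @[n --> \oo] --> f x) -> L1 g ->
  (forall n x, `|f_ n x| <= g x) ->
  \int[mu]_x f_ n x @[n --> \oo] --> \int[mu]_x f x.
Proof.
move=> mf ff lg fg; apply: fine_cvg.
have mf' n : measurable_fun [set: R] (EFin \o f_ n).
  exact/measurable_EFinP.
have cf x : setT x -> (EFin \o f_ n) x @[n --> \oo] --> (EFin \o f) x.
  by move=> _; apply: cvg_EFin; [exact: nearW | exact: ff].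
have fg' n x : setT x -> (`|(EFin \o f_ n) x| <= (EFin \o g) x)%E.
  by move=> _ /=; rewrite lee_fin.
have mEf : measurable_fun [set: R] (EFin \o f).
  exact: (emeasurable_fun_cvg _ _ mf' cf).
have [|//|if_ _] := @dominated_convergence _ _ _ mu _ measurableT
    (fun n => EFin \o f_ n) (EFin \o f) (EFin \o g) mf' mEf _ lg.
- exact: aeW.
- by apply: aeW => x n; exact: fg'.
- by rewrite fineK//; exact: integrable_fin_num.
Qed.

(** The bound [b] makes the iterated integral of [|H|] finite, so Tonelli gives integrability on the
    plane and Fubini applies. Integrability of the slices lets [fine] commute with the inner
    integrals. *)
Lemma Rint_swap (H : R * R -> R) (b : R -> R) :
  measurable_fun [set: R * R] H -> L1 b ->
  (forall x, L1 (fun y => H (x, y))) -> (forall y, L1 (fun x => H (x, y))) ->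
  (forall y, \int[mu]_x `|H (x, y)| <= b y) ->
  \int[mu]_x \int[mu]_y H (x, y) = \int[mu]_y \int[mu]_x H (x, y).
Proof.
move=> mH lb lH1 lH2 Hb.
have mEH : measurable_fun [set: R * R] (EFin \o H) by exact/measurable_EFinP.
have iH : (mu \x mu)%E.-integrable [set: R * R] (EFin \o H).
  apply/integrable12ltyP => //.
  rewrite (@sfinite_Fubini _ _ _ _ _ mu mu (fun z => `|(EFin \o H) z|%E))//; last first.
    exact: measurableT_comp.
  apply: (le_lt_trans _ (integrable_lty measurableT lb)).
  apply: ge0_le_integral => //.
  - by move=> y _; exact: integral_ge0.
  - apply: (@measurable_fun_fubini_tonelli_G _ _ _ _ R mu (fun z => `|(EFin \o H) z|%E)) => //.
    exact: measurableT_comp.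
  - exact: (measurable_int mu).
  - move=> y _ /=; rewrite -(fineK (integrable_fin_num measurableT (L1_norm (lH2 y)))).
    by rewrite lee_fin; exact: Hb.
rewrite {1 3}/Rintegral; congr fine.
transitivity (\int[mu]_x \int[mu]_y (EFin \o H) (x, y))%E.
  by apply: eq_integral => x _; rewrite fineK// (integrable_fin_num measurableT (lH1 x)).
rewrite Fubini//.
by apply: eq_integral => y _; rewrite fineK// (integrable_fin_num measurableT (lH2 y)).
Qed.

(** With a cosine kernel for [phi] this is the multiplication formula for transforms. With [phi] a
    bounded function of a linear form it moves a convolution to the other factor. *)
Lemma Rint_swapM (phi : R * R -> R) (a b : R -> R) :
  measurable_fun [set: R * R] phi -> (forall z, `|phi z| <= 1) ->
  L1 a -> L1 b ->
  \int[mu]_x (a x * \int[mu]_y (phi (x, y) * b y)) =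
  \int[mu]_y (b y * \int[mu]_x (phi (x, y) * a x)).
Proof.
move=> mphi phi1 la lb.
have m1 (x : R) : measurable_fun [set: R] (fun y => phi (x, y)).
  by apply: measurableT_comp => //; exact: measurable_pair1.
have m2 (y : R) : measurable_fun [set: R] (fun x => phi (x, y)).
  by apply: measurableT_comp => //; exact: measurable_pair2.
have l1 x : L1 (fun y => phi (x, y) * b y) by exact: (@L1M_bounded 1).
have l2 y : L1 (fun x => phi (x, y) * a x) by exact: (@L1M_bounded 1).
pose H (z : R * R) := phi z * a z.1 * b z.2.
have E1 x : \int[mu]_y H (x, y) = a x * \int[mu]_y (phi (x, y) * b y).
  by rewrite -RintZ//; apply: eq_Rint => y; rewrite /H/=; ring.
have E2 y : \int[mu]_x H (x, y) = b y * \int[mu]_x (phi (x, y) * a x).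
  by rewrite -RintZ//; apply: eq_Rint => x; rewrite /H/=; ring.
under eq_Rint do rewrite -E1; under [in RHS]eq_Rint do rewrite -E2.
have ha : L1 (fun y => (\int[mu]_x `|a x|) * `|b y|) by apply/L1Z/L1_norm.
apply: Rint_swap ha _ _ _.
- apply: measurable_funM; [apply: measurable_funM => //|].
    by apply: measurableT_comp; [exact: L1_measurable|exact: measurable_fst].
  by apply: measurableT_comp; [exact: L1_measurable|exact: measurable_snd].
- move=> x; have := L1Z (a x) (l1 x); congr L1.
  by apply/funext => y; rewrite /H/=; ring.
- move=> y; have := L1Z (b y) (l2 y); congr L1.
  by apply/funext => x; rewrite /H/=; ring.
- move=> y; rewrite mulrC -RintZ; last exact: L1_norm.
  apply: le_Rintegral => //.
  + apply: L1_norm; have := L1Z (b y) (l2 y); congr L1.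
    by apply/funext => x; rewrite /H/=; ring.
  + exact/L1Z/L1_norm.
  + by move=> x _; rewrite /H/= !normrM mulrC ler_wpM2l// ler_piMl.
Qed.

Lemma Rint_gt0 f (a b d : R) : a < b -> 0 < d -> L1 f -> (forall x, 0 <= f x) ->
  (forall x, a <= x -> x <= b -> d <= f x) -> 0 < \int[mu]_x f x.
Proof.
move=> ab d0 lf f0 fd.
pose A := `[a, b]%classic : set R.
have mA : measurable A by exact: measurable_itv.
have lA : L1 (fun x => d * \1_A x) by apply: L1Z; exact: integrable_indic_itv.
have : \int[mu]_x (d * \1_A x) <= \int[mu]_x f x.
  apply: le_Rintegral => // x _.
  rewrite indicE; have [|_] := boolP (x \in A); last by rewrite mulr0.
  by move=> /set_mem; rewrite /A/= in_itv/= mulr1 => /andP[? ?]; exact: fd.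
apply: lt_le_trans; rewrite RintZ; last exact: integrable_indic_itv.
rewrite mulr_gt0//.
have muA : mu A = (b - a)%:E by rewrite /A lebesgue_measure_itv/= lte_fin ab.
have e : (\int[mu]_x (\1_A x)%:E = (b - a)%:E)%E.
  by rewrite integral_indic// setIT; exact: muA.
by rewrite /Rintegral e/= subr_gt0.
Qed.

(** A point is a null set. This serves the limit of the dilates [sinc2 (e * t)] as [e] tends to 0,
    which is 1 only for [t != 0]. *)
Lemma Rint_neq0 f : measurable_fun [set: R] f ->
  \int[mu]_x (f x * (x != 0)%:R) = \int[mu]_x f x.
Proof.
move=> mf; congr fine; apply: ae_eq_integral => //.
- apply/measurable_EFinP; apply: measurable_funM => //.
  rewrite (_ : (fun x : R => _) = \1_[set~ (0 : R)]).
    by apply: measurable_indic; apply: measurableC; exact: measurable_set1.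
  apply/funext => x; rewrite indicE; have [->|/eqP x0] := eqVneq x 0.
    by rewrite memNset//= => /(_ erefl).
  by rewrite mem_set.
- exact/measurable_EFinP.
exists [set 0]; split => //; first exact: lebesgue_measure_set1.
move=> x /=; apply: contra_notP => /eqP x0 _.
by rewrite x0 mulr1.
Qed.

End Integration.

(** * Integrals of Fejer kernels and recovery of a value from modulated kernels *)

Section Fejer.
Variable R : realType.
Implicit Types (f g u : R -> R) (a b x : R).
Local Notation mu := (@lebesgue_measure R).

Lemma measurable_inv : measurable_fun [set: R] (fun x => x^-1).
Proof.
have mN0 : measurable [set~ (0 : R)] by apply: measurableC; exact: measurable_set1.
rewrite -(setUv [set 0]); apply/measurable_funU => //; split.
  exact: measurable_fun_set1.
apply: open_continuous_measurable_fun.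
  by apply: closed_openC; exact: closed_eq.
by move=> x; rewrite inE/= => /eqP x0; exact: inv_continuous.
Qed.

Lemma continuous_cos_affine a b : continuous (fun x => cos (a * x - b)).
Proof.
move=> x; apply: (@continuous_comp _ _ _ (fun x => a * x - b)); last exact: continuous_cos.
apply: cvgB; [apply: cvgM; [exact: cvg_cst|exact: cvg_id]|exact: cvg_cst].
Qed.

Lemma measurable_cos_affine a b : measurable_fun [set: R] (fun x => cos (a * x - b)).
Proof. by apply: continuous_measurable_fun; exact: continuous_cos_affine. Qed.

Lemma measurable_cosM a : measurable_fun [set: R] (fun x => cos (a * x)).
Proof.
rewrite (_ : (fun _ => _) = (fun x => cos (a * x - 0))); last first.
  by apply/funext => x; rewrite subr0.
exact: measurable_cos_affine.
Qed.

(** Keeping the intermediate point [c] gives both [sin x ^ 2 <= x ^ 2] and, through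
    [cos c ^ 2 = 1 - sin c ^ 2], the lower bound for [sinc2]. *)
Lemma sin_mean_value x : exists2 c, c ^+ 2 <= x ^+ 2 & sin x = cos c * x.
Proof.
wlog x0 : x / 0 <= x.
  move=> H; have [/H//|/ltW x0] := leP 0 x.
  have [|c cx E] := H (- x); first by rewrite oppr_ge0.
  by exists c; [rewrite -(sqrrN x)|rewrite -[sin x]opprK -sinN E mulrN opprK].
have [|c] := @MVT_segment R (@sin R) cos 0 x x0 (fun y _ => is_derive_sin y).
  by apply: continuous_subspaceT => y; exact: continuous_sin.
rewrite in_itv/= => /andP[c0 cx]; rewrite sin0 !subr0 => E.
by exists c => //; rewrite lerXn2r// nnegrE.
Qed.

Lemma sin_sqr_le x : sin x ^+ 2 <= x ^+ 2.
Proof.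
have [c _ ->] := sin_mean_value x.
by rewrite exprMn ler_piMl ?sqr_ge0// cos2sin2 gerBl sqr_ge0.
Qed.

Lemma one_minus_cos x : 1 - cos x = 2 * sin (x / 2) ^+ 2.
Proof.
have {1}-> : x = x / 2 + x / 2 by field.
by rewrite cosD -!expr2 cos2sin2; ring.
Qed.

Definition vers b x : R := (1 - cos (b * x)) / x ^+ 2.

Lemma vers_ge0 b x : 0 <= vers b x.
Proof. by rewrite /vers divr_ge0 ?sqr_ge0// subr_ge0 cos_le1. Qed.

Lemma measurable_vers b : measurable_fun [set: R] (vers b).
Proof.
rewrite /vers; apply: measurable_funM.
  by apply: measurable_funB => //; exact: measurable_cosM.
rewrite (_ : (fun _ => _) = (fun x : R => x^-1 ^+ 2)); last first.
  by apply/funext => x; rewrite exprVn.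
by apply: measurable_funX; exact: measurable_inv.
Qed.

(** The bound [b ^ 2 * x ^ 2] on [1 - cos (b * x)] serves near the origin and the bound 2 at
    infinity; the constant is their sum. *)
Lemma vers_le b x : vers b x <= (2 + b ^+ 2) * (1 + x ^+ 2)^-1.
Proof.
have p1 : 0 < 1 + x ^+ 2 by rewrite ltr_pwDl// sqr_ge0.
have [->|x0] := eqVneq x 0.
  by rewrite /vers expr0n invr0 mulr0 mulr_ge0 ?invr_ge0// ?addr_ge0// sqr_ge0.
have x2 : 0 < x ^+ 2 by rewrite exprn_even_gt0.
rewrite ler_pdivrMr// mulrAC ler_pdivlMr// mulrDr mulr1.
have h1 : 1 - cos (b * x) <= b ^+ 2 * x ^+ 2.
  rewrite one_minus_cos.
  have h := sin_sqr_le (b * x / 2); have h0 := sqr_ge0 (b * x).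
  have e : (b * x / 2) ^+ 2 = (b * x) ^+ 2 / 4 by field.
  by rewrite e in h; rewrite -exprMn; lra.
have h2 : (1 - cos (b * x)) * x ^+ 2 <= 2 * x ^+ 2.
  by rewrite ler_pM2r// lerBlDr -lerBlDl (le_trans _ (cos_geN1 _))//; lra.
by lra.
Qed.

Lemma L1_vers b : L1 (vers b).
Proof.
apply: (L1_dominated (measurable_vers b) (L1Z (2 + b ^+ 2) (L1_oneDsqrV R))).
by move=> x; rewrite ger0_norm ?vers_ge0// vers_le.
Qed.

(** The classical value is [pi]; it is carried along as a positive normalising constant. *)
Definition fejer_mass : R := \int[mu]_x vers 1 x.

Lemma Rint_vers b : \int[mu]_x vers b x = `|b| * fejer_mass.
Proof.
wlog b0 : b / 0 <= b.
  move=> H; have [/H//|/ltW b0] := leP 0 b.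
  rewrite -normrN -H ?oppr_ge0//; apply: eq_Rint => x.
  by rewrite /vers mulNr cosN.
rewrite ger0_norm//; move: b0; rewrite le_eqVlt => /predU1P[<-|b0].
  rewrite mul0r -[RHS](Rint_zero R); apply: eq_Rint => x.
  by rewrite /vers mul0r cos0 subrr mul0r.
transitivity (\int[mu]_x (b ^+ 2 * vers 1 (b * x))).
  apply: eq_Rint => x; rewrite /vers mul1r exprMn [in RHS]invfM.
  by rewrite [in RHS]mulrCA [_ * (_^-1 * _)]mulrA mulfV ?mul1r// expf_neq0// gt_eqF.
rewrite RintZ; last by apply: L1_scale => //; exact: L1_vers.
rewrite Rint_scale//; last exact: L1_vers.
by rewrite /fejer_mass; field; rewrite gt_eqF.
Qed.

Lemma fejer_mass_gt0 : 0 < fejer_mass.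
Proof.
have pi0 := pi_gt0 R.
(* On this interval the cosine is nonpositive, so the integrand is at least [x ^- 2], hence at least
   [pi ^- 2]. *)
apply: (@Rint_gt0 _ _ (pi / 2) pi (pi ^- 2)) (L1_vers 1) (vers_ge0 1) _.
- by lra.
- by rewrite invr_gt0 exprn_gt0.
move=> x x1 x2; have x0 : 0 < x by rewrite (lt_le_trans _ x1)// divr_gt0.
rewrite /vers mul1r (@le_trans _ _ (x ^- 2))//.
  by rewrite lef_pV2 ?posrE ?exprn_gt0// lerXn2r// nnegrE ltW.
rewrite ler_peMl// ?invr_ge0 ?sqr_ge0// lerDl oppr_ge0.
rewrite (_ : x = x - pi / 2 + pi / 2); last by ring.
rewrite cosDpihalf oppr_le0 sin_ge0_pi//; lra.
Qed.

(* [sinc2 0 = 0] rather than [1], since [x / 0 = 0]. *)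
Definition sinc2 x : R := sin x ^+ 2 / x ^+ 2.

Lemma sinc2E x : sinc2 x = 2^-1 * vers 2 x.
Proof.
rewrite /sinc2 /vers one_minus_cos (_ : 2 * x / 2 = x); last by field.
by rewrite -!mulrA mulKf.
Qed.

Lemma sinc2_ge0 x : 0 <= sinc2 x.
Proof. by rewrite sinc2E mulr_ge0// vers_ge0. Qed.

Lemma sinc2_bounds x : x != 0 -> 1 - x ^+ 2 <= sinc2 x <= 1.
Proof.
move=> x0; have x2 : 0 < x ^+ 2 by rewrite exprn_even_gt0.
rewrite /sinc2 [X in _ && X]ler_pdivrMr// mul1r sin_sqr_le andbT.
have [c cx ->] := sin_mean_value x.
rewrite exprMn mulfK ?gt_eqF// cos2sin2 lerD2l lerN2.
exact: le_trans (sin_sqr_le c) cx.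
Qed.

Lemma L1_sinc2 : L1 sinc2.
Proof.
rewrite (_ : sinc2 = fun x => 2^-1 * vers 2 x); first exact/L1Z/L1_vers.
by apply/funext => x; exact: sinc2E.
Qed.

(** This is [1 - |a| / 2] on [[-2, 2]] and 0 elsewhere, written as a second difference of the
    absolute value so that it can be read off from [Rint_vers]. *)
Definition tent a : R := `|a + 2| / 4 + `|a - 2| / 4 - `|a| / 2.

Lemma tent_eq0 a : 2 <= `|a| -> tent a = 0.
Proof.
rewrite /tent; case: (lerP 0 a) => a0 a2.
  rewrite ger0_norm// in a2.
  by rewrite (@ger0_norm _ (a + 2)) ?(@ger0_norm _ (a - 2)) ?ger0_norm//; lra.
rewrite ltr0_norm// in a2.
by rewrite (@ler0_norm _ (a + 2)) ?(@ler0_norm _ (a - 2)) ?ltr0_norm//; lra.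
Qed.

Lemma tent_ge0 a : 0 <= tent a.
Proof.
rewrite /tent; have := ler_normD (a + 2) (a - 2).
rewrite (_ : a + 2 + (a - 2) = 2 * a); last by ring.
by rewrite normrM (@ger0_norm _ 2)//; lra.
Qed.

Lemma L1_sinc2_cos a b : L1 (fun x => cos (a * x - b) * sinc2 x).
Proof.
apply: (@L1M_bounded _ 1); first exact: measurable_cos_affine.
  by move=> x; exact: cos_max.
exact: L1_sinc2.
Qed.

(** The sine part is odd and drops out. By product-to-sum formulas [cos (a * x) * sinc2 x] is a
    combination of [vers] at [a + 2], [a - 2] and [a], whose integrals are absolute values. *)
Lemma Rint_sinc2_cos a b :
  \int[mu]_x (cos (a * x - b) * sinc2 x) = cos b * tent a * fejer_mass.
Proof.
have L1v := L1_vers.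
have L1c : L1 (fun x => cos (a * x) * sinc2 x).
  have := L1_sinc2_cos a 0; congr L1; apply/funext => x.
  by rewrite subr0.
have mS : measurable_fun [set: R] (fun x => sin (a * x) * sinc2 x).
  apply: measurable_funM; last exact: (L1_measurable L1_sinc2).
  have := measurable_cos_affine a (pi / 2).
  by congr measurable_fun; apply/funext => x; rewrite cosBpihalf.
have L1s : L1 (fun x => sin (a * x) * sinc2 x).
  apply: (L1_dominated mS L1_sinc2) => x.
  by rewrite normrM (ger0_norm (sinc2_ge0 x)) ler_piMl ?sinc2_ge0// sin_max.
have -> : \int[mu]_x (cos (a * x - b) * sinc2 x) =
    \int[mu]_x (cos b * (cos (a * x) * sinc2 x) + sin b * (sin (a * x) * sinc2 x)).
  by apply: eq_Rint => x; rewrite cosB; ring.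
rewrite RintD ?RintZ//; try exact: L1Z.
rewrite [X in _ + _ * X](_ : _ = 0); last first.
  apply: Rint_odd => // x.
  by rewrite /sinc2 mulrN !sinN !sqrrN mulNr.
rewrite mulr0 addr0 -mulrA; congr *%R.
have -> : \int[mu]_x (cos (a * x) * sinc2 x) =
    \int[mu]_x (4^-1 * vers (a + 2) x + 4^-1 * vers (a - 2) x - 2^-1 * vers a x).
  apply: eq_Rint => x; rewrite sinc2E /vers (mulrDl a) (mulrBl x a) cosD cosB.
  set w := (x ^+ 2)^-1; set p := cos (a * x); set q := sin _; set r := cos (2 * x).
  by set t := sin _; field.
rewrite RintB ?RintD ?RintZ//; try by [exact: L1Z|apply: L1D; exact: L1Z].
by rewrite !Rint_vers /tent; field.
Qed.

Lemma Rint_sinc2 : \int[mu]_x sinc2 x = fejer_mass.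
Proof.
transitivity (\int[mu]_x (cos (0 * x - 0) * sinc2 x)).
  by apply: eq_Rint => x; rewrite mul0r subr0 cos0 mul1r.
rewrite Rint_sinc2_cos cos0 /tent add0r sub0r normrN normr0 ger0_norm//.
by field.
Qed.

Lemma Rint_sinc2_modulated (c d b : R) :
  \int[mu]_x (cos (c * x - b) * (cos (d * x) * sinc2 x)) =
  cos b * fejer_mass * 2^-1 * (tent (c + d) + tent (c - d)).
Proof.
transitivity (\int[mu]_x (2^-1 * (cos ((c + d) * x - b) * sinc2 x) +
   2^-1 * (cos ((c - d) * x - b) * sinc2 x))).
  apply: eq_Rint => x.
  rewrite (_ : (c + d) * x - b = (c * x - b) + d * x); last by ring.
  rewrite (_ : (c - d) * x - b = (c * x - b) - d * x); last by ring.
  rewrite (cosD (c * x - b)) (cosB (c * x - b)); set w := sinc2 x; set p := cos (c * x - b).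
  by set q := sin (c * x - b); set r := cos (d * x); set t := sin (d * x); field.
rewrite RintD ?RintZ; try by [exact: L1_sinc2_cos|apply: L1Z; exact: L1_sinc2_cos].
by rewrite !Rint_sinc2_cos; ring.
Qed.

(** The Dirichlet kernel in the variable [2 x], which contains only the frequencies [2 k];
    [fejer_sum] is the Fejer kernel without its averaging factor. *)
Fixpoint dirichlet (m : nat) x : R :=
  if m is m'.+1 then dirichlet m' x + 2 * cos (2 * m%:R * x) else 1.

Fixpoint fejer_sum (M : nat) x : R :=
  if M is M'.+1 then fejer_sum M' x + dirichlet M' x else 0.

Lemma dirichletE m x : sin x * dirichlet m x = sin ((2 * m + 1)%N%:R * x).
Proof.
elim: m => [|m IH] /=; first by rewrite muln0 add0n mulr1 mul1r.
rewrite mulrDr IH.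
rewrite (_ : (2 * m + 1)%:R * x = 2 * m.+1%:R * x - x); last first.
  by rewrite natrD natrM -addn1 natrD; ring.
rewrite (_ : (2 * m.+1 + 1)%:R * x = 2 * m.+1%:R * x + x); last first.
  by rewrite natrD natrM; ring.
by rewrite sinB sinD; ring.
Qed.

(** The sum telescopes, since [sin x * sin ((2 M + 1) x)] is the difference of [sin ((M + 1) x) ^ 2]
    and [sin (M x) ^ 2]. Multiplying by [sin x ^ 2] avoids dividing by its zeros. *)
Lemma fejer_sumE M x : sin x ^+ 2 * fejer_sum M x = sin (M%:R * x) ^+ 2.
Proof.
elim: M => [|M IH] /=; first by rewrite mulr0 mul0r sin0 expr0n.
rewrite mulrDr IH expr2 -mulrA dirichletE.
rewrite (_ : M%:R * x = (2 * M + 1)%:R * x / 2 - x / 2); last first.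
  by rewrite natrD natrM; field.
rewrite (_ : M.+1%:R * x = (2 * M + 1)%:R * x / 2 + x / 2); last first.
  by rewrite -[M.+1]addn1 !natrD ?natrM; field.
set p := (2 * M + 1)%:R * x.
have -> : sin x = sin (x / 2 + x / 2) by congr sin; field.
have -> : sin p = sin (p / 2 + p / 2) by congr sin; field.
rewrite sinB !sinD.
by ring.
Qed.

(** By linearity [u] is orthogonal to every [fejer_sum N x * sinc2 x], which is
    [sin (N x) ^ 2 / x ^ 2]. These kernels concentrate at 0, so in the limit [u 0] times the
    positive mass vanishes. *)
Lemma fejer_separation u (M : R) : continuous u -> (forall x, `|u x| <= M) ->
  (forall k : nat, \int[mu]_x (u x * (cos (2 * k%:R * x) * sinc2 x)) = 0) ->
  u 0 = 0.
Proof.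
move=> cu uM H.
have mu_ := continuous_measurable_fun cu.
have L1u f : L1 f -> L1 (fun x => u x * f x) by exact: L1M_bounded.
have L1c k : L1 (fun x => cos (2 * k%:R * x) * sinc2 x).
  by have := L1_sinc2_cos (2 * k%:R) 0; congr L1; apply/funext => x; rewrite subr0.
have D m : L1 (fun x => u x * (dirichlet m x * sinc2 x)) /\
    \int[mu]_x (u x * (dirichlet m x * sinc2 x)) = 0.
  elim: m => [|m [IH1 IH2]] /=.
    have e : (fun x => u x * (1 * sinc2 x)) =
        (fun x => u x * (cos (2 * 0%:R * x) * sinc2 x)).
      by apply/funext => x; rewrite mulr0 mul0r cos0.
    by rewrite e; split; [exact/L1u/L1c | exact: H].
  have e : (fun x => u x * ((dirichlet m x + 2 * cos (2 * m.+1%:R * x)) * sinc2 x)) =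
      (fun x => u x * (dirichlet m x * sinc2 x) +
        2 * (u x * (cos (2 * m.+1%:R * x) * sinc2 x))).
    by apply/funext => x; ring.
  rewrite e; split; first by apply: L1D => //; exact/L1Z/L1u/L1c.
  rewrite RintD//; last exact/L1Z/L1u/L1c.
  by rewrite RintZ ?IH2 ?H ?mulr0 ?addr0//; exact/L1u/L1c.
have F N : L1 (fun x => u x * (fejer_sum N x * sinc2 x)) /\
    \int[mu]_x (u x * (fejer_sum N x * sinc2 x)) = 0.
  elim: N => [|N [IH1 IH2]] /=.
    have e : (fun x => u x * (0 * sinc2 x)) = (fun x => 0 * sinc2 x).
      by apply/funext => x; rewrite mul0r mulr0.
    rewrite e; split; first exact/L1Z/L1_sinc2.
    by rewrite RintZ ?mul0r//; exact: L1_sinc2.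
  have e : (fun x => u x * ((fejer_sum N x + dirichlet N x) * sinc2 x)) =
      (fun x => u x * (fejer_sum N x * sinc2 x) + u x * (dirichlet N x * sinc2 x)).
    by apply/funext => x; ring.
  have [D1 D2] := D N.
  by rewrite e; split; [exact: L1D | rewrite RintD// IH2 D2 addr0].
(* Since [fejer_sum N x * sinc2 x] equals [N ^ 2 * sinc2 (N * x)], a change of variables moves the
   dilation onto [u]. *)
have S N : \int[mu]_x (u (N.+1%:R^-1 * x) * sinc2 x) = 0.
  have N0 : 0 < N.+1%:R :> R by rewrite ltr0n.
  pose h x := u (N.+1%:R^-1 * x) * sinc2 x.
  have L1h : L1 h.
    apply: L1M_bounded L1_sinc2 => //.
    by apply: measurableT_comp => //; exact: measurable_funM.
  have [FN1 FN2] := F N.+1.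
  have : \int[mu]_x h (N.+1%:R * x) = 0.
    rewrite (_ : \int[mu]_x h (N.+1%:R * x) =
      \int[mu]_x (N.+1%:R^-1 ^+ 2 * (u x * (fejer_sum N.+1 x * sinc2 x)))).
      by rewrite RintZ// FN2 mulr0.
    apply: eq_Rint => x; rewrite /h mulKf ?gt_eqF//.
    rewrite /sinc2 (mulrA (fejer_sum _ _)) (mulrC (fejer_sum _ _)) fejer_sumE.
    by rewrite exprMn invfM exprVn; ring.
  rewrite (Rint_scale N0 L1h) => /eqP; rewrite mulf_eq0 => /orP[|/eqP//].
  by rewrite invr_eq0 gt_eqF.
have : \int[mu]_x (u (n.+1%:R^-1 * x) * sinc2 x) @[n --> \oo] -->
    \int[mu]_x (u 0 * sinc2 x).
  apply: (@Rint_dominated_cvg _ _ _ (fun x => M * sinc2 x)).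
  - move=> n; apply: measurable_funM; last exact: (L1_measurable L1_sinc2).
    by apply: measurableT_comp => //; exact: measurable_funM.
  - move=> x; apply: cvgM; last exact: cvg_cst.
    apply: (@cvg_comp _ _ _ (fun n : nat => n.+1%:R^-1 * x) u _ (nbhs (0 : R))); last exact: cu.
    rewrite -(mul0r x); apply: cvgM; last exact: cvg_cst.
    exact: cvg_harmonic.
  - exact/L1Z/L1_sinc2.
  - by move=> n x; rewrite normrM (ger0_norm (sinc2_ge0 x)) ler_wpM2r ?sinc2_ge0.
rewrite (_ : (fun n : nat => _) = (fun=> 0)); last exact/funext.
move=> /(cvg_unique (@Rhausdorff R) (cvg_cst _))/esym.
rewrite RintZ; last exact: L1_sinc2.
rewrite Rint_sinc2 => /eqP; rewrite mulf_eq0 => /orP[/eqP//|].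
by rewrite gt_eqF// fejer_mass_gt0.
Qed.

End Fejer.

(** * Schwartz functions and their Fourier transforms *)


Section Schwartz.
Variable R : realType.
Implicit Types (f g : R -> R) (a b x t h : R).
Local Notation mu := (@lebesgue_measure R).

Definition fast_decay f := forall k : nat, exists C : R,
  forall x, `|x ^+ k * f x| <= C.

(* The Schwartz estimates for the first [n] derivatives; the derivatives are
   existential witnesses, which makes closure properties direct inductions. *)
Fixpoint decay_upto (n : nat) f : Prop :=
  fast_decay f /\
  if n is n'.+1 then
    exists2 f' : R -> R, (forall x, is_derive x 1 f (f' x)) & decay_upto n' f'
  else True.

Lemma decay_upto_fast n f : decay_upto n f -> fast_decay f.
Proof. by case: n => [|n] []. Qed.

Lemma derive1_fun f (f' : R -> R) : (forall x, is_derive x 1 f (f' x)) ->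
  derive1 f = f'.
Proof. by move=> df; apply/funext => x; rewrite derive1E; apply: derive_val. Qed.

(** The derivative witnesses for different [n] are unrelated a priori; uniqueness of derivatives
    identifies each of them with [derive1 f], which drives the inductions. *)
Lemma schwartz_decay_upto f : schwartz_real f <-> forall n, decay_upto n f.
Proof.
split.
  move=> [sm de] n; elim: n f sm de => [|n IH] f sm de; split => //=;
    try by move=> k; exact: de k 0%N.
  exists (derive1 f).
    by move=> x; have := derivableP (sm 0%N x); rewrite derive1E.
  apply: IH => [m x|k m]; rewrite -derive1Sn//.
move=> H; split.
  move=> n; elim: n f H => [|n IH] f H x.
    by have [_ [f' df _]] := H 1%N; case: (df x).
  have [_ [f' df _]] := H 1%N.
  rewrite derive1Sn (derive1_fun df); apply: IH => m.
  have [_ [g' dg]] := H m.+1.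
  by rewrite -(derive1_fun dg) (derive1_fun df).
move=> k n; elim: n f H => [|n IH] f H.
  by have [+ _] := H 0%N; apply.
have [_ [f' df _]] := H 1%N.
have [m|C HC] := IH f'; last by exists C => x; rewrite derive1Sn (derive1_fun df).
have [_ [g' dg]] := H m.+1.
by rewrite -(derive1_fun dg) (derive1_fun df).
Qed.

Lemma fast_decayD f g : fast_decay f -> fast_decay g ->
  fast_decay (fun x => f x + g x).
Proof.
move=> F G k; have [C hC] := F k; have [D hD] := G k; exists (C + D) => x.
by rewrite mulrDr (le_trans (ler_normD _ _))// lerD.
Qed.

Lemma fast_decayM_bounded f g (M : R) : (forall x, `|g x| <= M) -> fast_decay f ->
  fast_decay (fun x => g x * f x).
Proof.
move=> gM F k; have [C hC] := F k; exists (M * C) => x.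
rewrite mulrCA normrM ler_pM//.
Qed.

Lemma fast_decay_scale f a : 0 < a -> fast_decay f ->
  fast_decay (fun x => f (a * x)).
Proof.
move=> a0 F k; have [C hC] := F k; exists (a ^- k * C) => x.
have -> : x ^+ k * f (a * x) = a ^- k * ((a * x) ^+ k * f (a * x)).
  by rewrite mulrA exprMn mulKf// expf_neq0// gt_eqF.
by rewrite normrM ler_pM// ger0_norm// invr_ge0 exprn_ge0// ltW.
Qed.

Lemma decay_uptoZ n (c : R) f : decay_upto n f -> decay_upto n (fun x => c * f x).
Proof.
elim: n f => [|n IH] f /=; move=> [F H]; split;
  try exact: (fast_decayM_bounded (fun=> lexx `|c|)).
  by [].
case: H => f' df Hf'; exists (fun x => c * f' x); last exact: IH.
by move=> x; exact: (is_deriveZ c (df x)).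
Qed.

Lemma decay_uptoD n f g : decay_upto n f -> decay_upto n g ->
  decay_upto n (fun x => f x + g x).
Proof.
elim: n f g => [|n IH] f g /=; move=> [F H] [G K]; split;
  try exact: fast_decayD.
  by [].
case: H => f' df Hf'; case: K => g' dg Kg'.
exists (fun x => f' x + g' x); last exact: IH.
by move=> x; exact: (is_deriveD (df x) (dg x)).
Qed.

Lemma decay_uptoB n f g : decay_upto n f -> decay_upto n g ->
  decay_upto n (fun x => f x - g x).
Proof.
move=> F /(decay_uptoZ (-1)) G; rewrite (_ : (fun _ => _) = (fun x => f x + -1 * g x)).
  exact: decay_uptoD.
by apply/funext => x; rewrite mulN1r.
Qed.

Lemma decay_uptoW n f : decay_upto n.+1 f -> decay_upto n f.
Proof.
elim: n f => [|n IH] f /= [F [f' df [F' H]]]; split => //.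
by exists f' => //; apply: IH.
Qed.

Lemma is_derive_affine a b x : is_derive x 1 (fun x => a * x - b) a.
Proof.
have -> : (fun x => a * x - b) = (fun x : R => a *: x) - cst b.
  by apply/funext => y.
apply: (is_derive_eq (is_deriveB (is_deriveZ a (is_derive_id x 1)) (is_derive_cst b x 1))).
by rewrite subr0 -[_ *: _]/(a * 1) mulr1.
Qed.

Lemma is_derive_cos_affine a b x :
  is_derive x 1 (fun x => cos (a * x - b)) (- a * cos (a * x - (b + pi / 2))).
Proof.
have := @is_derive1_comp _ (@cos R) (fun x => a * x - b) x _ _
  (is_derive_cos (a * x - b)) (is_derive_affine a b x).
move=> /is_derive_eq; apply.
by rewrite opprD addrA cosBpihalf; ring.
Qed.

(** Differentiating the cosine shifts its phase by [pi / 2], so the induction is over all phases [b]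
    at once. *)
Lemma decay_upto_cosM n a b f : decay_upto n f ->
  decay_upto n (fun x => cos (a * x - b) * f x).
Proof.
elim: n b f => [|n IH] b f /=; move=> [F H]; split;
  try exact: (fast_decayM_bounded (fun x => cos_max (a * x - b))).
  by [].
case: H => f' df Hf'.
exists (fun x => - a * (cos (a * x - (b + pi / 2)) * f x) + cos (a * x - b) * f' x).
  move=> x; apply: (is_derive_eq (is_deriveM (is_derive_cos_affine a b x) (df x))).
  by rewrite -![_ *: _]/(_ * _); ring.
apply: decay_uptoD; last exact: IH.
apply/decay_uptoZ/IH/decay_uptoW; split => //.
by exists f'.
Qed.

Lemma decay_upto_scale n a f : 0 < a -> decay_upto n f ->
  decay_upto n (fun x => f (a * x)).
Proof.
move=> a0; elim: n f => [|n IH] f /=; move=> [F H]; split;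
  try exact: fast_decay_scale.
  by [].
case: H => f' df Hf'; exists (fun x => a * f' (a * x)); last exact/decay_uptoZ/IH.
move=> x; rewrite mulrC.
have da := is_derive_affine a 0 x.
have -> : (fun x => f (a * x)) = f \o (fun x => a * x - 0).
  by apply/funext => y /=; rewrite subr0.
by apply: is_derive1_comp; rewrite subr0.
Qed.

Lemma fast_decay_oneDsqr f : fast_decay f ->
  exists2 C : R, 0 <= C & forall x, `|f x| <= C * (1 + x ^+ 2)^-1.
Proof.
move=> F; have [C hC] := F 0%N; have [D hD] := F 2%N.
have H x : `|f x| <= (C + D) * (1 + x ^+ 2)^-1.
  rewrite ler_pdivlMr; last by rewrite ltr_pwDl// sqr_ge0.
  rewrite mulrDr mulr1 lerD//; first by have := hC x; rewrite mul1r.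
  by have := hD x; rewrite normrM (ger0_norm (sqr_ge0 x)) mulrC.
exists (C + D) => //.
by have := le_trans (normr_ge0 _) (H 0); rewrite expr0n addr0 invr1 mulr1.
Qed.

Lemma is_derive_continuous f (f' : R -> R) : (forall x, is_derive x 1 f (f' x)) ->
  continuous f.
Proof.
move=> df x; apply/differentiable_continuous/derivable1_diffP.
by case: (df x).
Qed.

Lemma decay_upto_continuous n f : decay_upto n.+1 f -> continuous f.
Proof. by case=> _ [f' /is_derive_continuous]. Qed.

Lemma decay_upto_L1 n f : decay_upto n.+1 f -> L1 f.
Proof.
move=> F; have [C _ hC] := fast_decay_oneDsqr (decay_upto_fast F).
apply: (L1_dominated _ (L1Z C (L1_oneDsqrV R)) hC).
by apply: continuous_measurable_fun; exact: (decay_upto_continuous F).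
Qed.

(* The phase makes this both transforms at once: [wave g 0] is the cosine
   transform and [wave g (pi / 2)] the sine transform. *)
Definition wave g (th t : R) : R := \int[mu]_x (cos (2 * pi * t * x - th) * g x).

Lemma L1_cosM g a b : L1 g -> L1 (fun x => cos (a * x - b) * g x).
Proof.
apply: (@L1M_bounded _ 1); first exact: measurable_cos_affine.
by move=> x; exact: cos_max.
Qed.

Lemma waveB g1 g2 th t : L1 g1 -> L1 g2 ->
  wave (fun x => g1 x - g2 x) th t = wave g1 th t - wave g2 th t.
Proof.
move=> l1 l2; rewrite /wave -RintB; try exact: L1_cosM.
by apply: eq_Rint => x; rewrite mulrBr.
Qed.

(** Translating a transform amounts to modulating [g]; with real kernels the modulation splits into
    a cosine and a sine term. *)
Lemma wave_translate g th s t : L1 g ->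
  wave g th (t - s) = wave (fun x => cos (2 * pi * s * x - 0) * g x) th t +
    wave (fun x => cos (2 * pi * s * x - pi / 2) * g x) (th + pi / 2) t.
Proof.
move=> lg; rewrite /wave -RintD; try by do 2 apply: L1_cosM.
apply: eq_Rint => x.
rewrite (_ : 2 * pi * (t - s) * x - th = 2 * pi * t * x - th - 2 * pi * s * x); last by ring.
by rewrite cosB subr0 cosBpihalf opprD addrA cosBpihalf; ring.
Qed.

Lemma wave_scale g th a t : 0 < a -> L1 g ->
  wave (fun x => g (a * x)) th t = a^-1 * wave g th (a^-1 * t).
Proof.
move=> a0 lg; rewrite /wave -Rint_scale//; last exact: L1_cosM.
by apply: eq_Rint => x; congr (cos _ * _); field; rewrite gt_eqF.
Qed.

Lemma continuous_wave g th : L1 g -> continuous (wave g th).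
Proof.
move=> lg t; apply/(@cvg_nbhsP _ R^o) => w wt.
apply: (@Rint_dominated_cvg _ _ _ (fun x => `|g x|)).
- by move=> n; apply: (L1_measurable (L1_cosM _ _ lg)).
- move=> x; apply: cvgM; last exact: cvg_cst.
  apply: continuous_cvg; first exact: continuous_cos.
  apply: cvgB; last exact: cvg_cst.
  apply: cvgM; last exact: cvg_cst.
  by apply: cvgM => //; exact: cvg_cst.
- exact: L1_norm.
- by move=> n x; rewrite normrM ler_piMl// cos_max.
Qed.

Lemma oneDsqrV_near (x d : R) : `|x - d| <= 1 ->
  (1 + d ^+ 2)^-1 <= 3 * (1 + x ^+ 2)^-1.
Proof.
move=> xd; have p1 (y : R) : 0 < 1 + y ^+ 2 by rewrite ltr_pwDl// sqr_ge0.
rewrite ler_pdivlMr// mulrC ler_pdivrMr//.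
have : (x - d) ^+ 2 <= 1.
  by rewrite -real_normK ?num_real// expr_le1.
(* This square equals [2 (x - d) ^ 2 + 2 d ^ 2 - x ^ 2], so [1 + x ^ 2 <= 3 + 2 d ^ 2]. *)
have : 0 <= (x - 2 * d) ^+ 2 by exact: sqr_ge0.
by rewrite !expr2; nra.
Qed.

(** The mean value theorem is used twice: for [s |-> f (x + s) + f (x - s)] on [[0, h]], then for
    [f'] on [[x - c, x + c]]. The constant 6 is the 2 from the length of that interval times the 3
    of [oneDsqrV_near]. *)
Lemma second_difference_le f (f' f'' : R -> R) (C h x : R) :
  (forall x, is_derive x 1 f (f' x)) -> (forall x, is_derive x 1 f' (f'' x)) ->
  0 <= C -> (forall x, `|f'' x| <= C * (1 + x ^+ 2)^-1) -> `|h| <= 1 ->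
  `|f (x + h) + f (x - h) - 2 * f x| <= 6 * C * h ^+ 2 * (1 + x ^+ 2)^-1.
Proof.
move=> df df' C0 hC.
wlog h0 : h / 0 <= h.
  move=> H; have [/H//|/ltW h0 h1] := leP 0 h.
  have := H (- h); rewrite oppr_ge0 normrN opprK sqrrN => /(_ h0 h1).
  by rewrite [f (x - h) + _]addrC.
rewrite ger0_norm// => h1.
have c1 : continuous f' by exact: is_derive_continuous df'.
pose phi s := f (x + s) + f (x - s).
have dphi (s : R) : is_derive s 1 phi (f' (x + s) - f' (x - s)).
  have d1 : is_derive s 1 (fun s => 1 * s - (- x)) 1 by exact: is_derive_affine.
  have d2 : is_derive s 1 (fun s => -1 * s - (- x)) (-1) by exact: is_derive_affine.
  have e1 : 1 * s - (- x) = x + s by rewrite mul1r opprK addrC.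
  have e2 : -1 * s - (- x) = x - s by rewrite mulN1r opprK addrC.
  have D1 : is_derive s 1 (f \o (fun s => 1 * s - (- x))) (f' (x + s) * 1).
    by apply: is_derive1_comp; rewrite e1.
  have D2 : is_derive s 1 (f \o (fun s => -1 * s - (- x))) (f' (x - s) * -1).
    by apply: is_derive1_comp; rewrite e2.
  have -> : phi = (f \o (fun s => 1 * s - (- x))) + (f \o (fun s => -1 * s - (- x))).
    by apply/funext => y; rewrite /phi fctE/= mul1r mulN1r !opprK ![_ + x]addrC.
  by apply: (is_derive_eq (is_deriveD D1 D2)); rewrite mulr1 mulrN1.
have [|c ch E1] := @MVT_segment R phi _ 0 h h0 (fun s _ => dphi s).
  by apply: continuous_subspaceT; exact: is_derive_continuous dphi.
move: ch; rewrite in_itv/= => /andP[c0' ch].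
have [||d dI E2] := @MVT_segment R f' f'' (x - c) (x + c) _ (fun s _ => df' s).
- by lra.
- exact: continuous_subspaceT.
move: dI; rewrite in_itv/= => /andP[d1 d2].
have -> : f (x + h) + f (x - h) - 2 * f x = f'' d * (2 * c * h).
  have -> : f (x + h) + f (x - h) - 2 * f x = phi h - phi 0.
    by rewrite /phi addr0 subr0; ring.
  by rewrite E1 E2 subr0; ring.
have q1 : (1 + d ^+ 2)^-1 <= 3 * (1 + x ^+ 2)^-1.
  by apply: oneDsqrV_near; rewrite ler_norml; lra.
rewrite normrM (ger0_norm (_ : 0 <= 2 * c * h)); last by rewrite !mulr_ge0.
apply: (@le_trans _ _ (C * (3 * (1 + x ^+ 2)^-1) * (2 * h * h))).
  apply: ler_pM => //; first by rewrite !mulr_ge0.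
    by rewrite (le_trans (hC d))// ler_wpM2l.
  by rewrite ler_wpM2r// ler_wpM2l.
by rewrite expr2 le_eqVlt; apply/orP; left; apply/eqP; ring.
Qed.

(* Shifting [g] by [1 / (2 t)] or [- 1 / (2 t)] changes the sign of [wave g th t],
   so [4 * wave g th t] is the transform of a second difference of [g], which is
   [O (1 / t ^ 2)]. *)
Lemma wave_decay g th : decay_upto 3 g ->
  exists C : R, forall t, `|wave g th t| <= C * (1 + t ^+ 2)^-1.
Proof.
move=> G; have lg := decay_upto_L1 G.
have [F0 [g' dg [_ [g'' dg' G'']]]] := G.
have [C0 C0p hC0] := fast_decay_oneDsqr F0.
have [C Cp hC] := fast_decay_oneDsqr G''.1.
pose N := \int[mu]_x (1 + x ^+ 2)^-1.
have L1N := L1_oneDsqrV R.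
have p1 (y : R) : 0 < 1 + y ^+ 2 by rewrite ltr_pwDl// sqr_ge0.
have N0 : 0 <= N by apply: Rintegral_ge0 => x _; rewrite invr_ge0 ltW.
have mW (t : R) : measurable_fun [set: R] (fun x => cos (2 * pi * t * x - th) * g x).
  exact: (L1_measurable (L1_cosM _ _ lg)).
have B0 t : `|wave g th t| <= C0 * N.
  rewrite /N -RintZ//; apply: Rint_norm_le => //; first exact: L1Z.
  by move=> x; rewrite normrM (le_trans _ (hC0 x))// ler_piMl// cos_max.
(* The threshold 1/2 makes the shift [h = 1 / (2 t)] at most 1 in absolute value, as the second
   difference estimate requires. *)
have B1 t : 1 / 2 <= `|t| -> t ^+ 2 * `|wave g th t| <= C * N.
  move=> ht; have t0 : t != 0 by apply: contraTneq ht => ->; rewrite normr0; lra.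
  pose h := (2 * t)^-1.
  have hh : `|h| <= 1.
    by rewrite /h normfV invf_le1 normrM ger0_norm// ?mulr_gt0 ?normr_gt0//; lra.
  have S s : (s = 1) \/ (s = -1) ->
      \int[mu]_x (cos (2 * pi * t * x - th) * g (x + s * h)) = - wave g th t.
    move=> s1.
    pose G0 y := cos (2 * pi * t * y - (th + s * pi)) * g y.
    transitivity (\int[mu]_x G0 (x + s * h)).
      apply: eq_Rint => x; rewrite /G0; congr (cos _ * _).
      by rewrite /h; field.
    rewrite (@Rint_shift _ _ G0); last exact: L1_cosM.
    rewrite /wave -[RHS]mulN1r -RintZ; last exact: L1_cosM.
    apply: eq_Rint => x; rewrite mulN1r -mulNr; congr (_ * _).
    rewrite opprD addrA; case: s1 => ->; rewrite ?mul1r ?mulN1r ?opprK.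
      by rewrite cosB cospi sinpi; ring.
    by rewrite cosDpi.
  have L1s s : L1 (fun x => cos (2 * pi * t * x - th) * g (x + s)).
    by apply: L1_cosM; exact: L1_shift.
  have E : - 4 * wave g th t = \int[mu]_x
      (cos (2 * pi * t * x - th) * (g (x + h) + g (x - h) - 2 * g x)).
    transitivity (\int[mu]_x (cos (2 * pi * t * x - th) * g (x + 1 * h) +
        cos (2 * pi * t * x - th) * g (x + -1 * h) -
        2 * (cos (2 * pi * t * x - th) * g x))).
      have l1 := L1s (1 * h); have l2 := L1s (-1 * h).
      rewrite RintB; [|exact: L1D|by apply: L1Z; exact: L1_cosM].
      rewrite RintD// RintZ; last exact: L1_cosM.
      rewrite (S 1 (or_introl erefl)) (S (-1) (or_intror erefl)) -/(wave g th t).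
      by ring.
    by apply: eq_Rint => x; rewrite mul1r mulN1r; ring.
  have : `|- 4 * wave g th t| <= 6 * C * h ^+ 2 * N.
    rewrite E /N -RintZ//; apply: Rint_norm_le.
    - rewrite (_ : (fun _ => _) = (fun x => cos (2 * pi * t * x - th) * g (x + h) +
        cos (2 * pi * t * x - th) * g (x - h) - 2 * (cos (2 * pi * t * x - th) * g x))).
        apply: measurable_funB; [apply: measurable_funD|apply: measurable_funM => //].
        + exact: (L1_measurable (L1s h)).
        + exact: (L1_measurable (L1s (- h))).
      by apply/funext => x; ring.
    - exact: L1Z.
    - move=> x; apply: (le_trans _ (second_difference_le x dg dg' Cp hC hh)).
      by rewrite normrM ler_piMl// cos_max.
  rewrite normrM normrN (@ger0_norm _ 4)//.
  have : 0 <= t ^+ 2 by exact: sqr_ge0.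
  have -> : h ^+ 2 = (4 * t ^+ 2)^-1 by rewrite /h; field.
  move=> t2 /(ler_wpM2l t2).
  have -> : t ^+ 2 * (6 * C / (4 * t ^+ 2) * N) = 3 / 2 * (C * N) by field.
  have : 0 <= C * N by exact: mulr_ge0.
  by lra.
exists (2 * (C0 * N) + C * N) => t.
rewrite ler_pdivlMr// mulrC mulrDl mul1r.
have := B0 t; have := B1 t; have [ht|ht] := lerP (1 / 2) `|t|.
  move=> /(_ isT); have := mulr_ge0 C0p N0; lra.
move=> _ b0; have : t ^+ 2 * `|wave g th t| <= 1 * `|wave g th t|.
  rewrite ler_wpM2r// -real_normK ?num_real// expr_le1//; lra.
have := mulr_ge0 Cp N0; lra.
Qed.

Lemma L1_wave g th : decay_upto 3 g -> L1 (wave g th).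
Proof.
move=> G; have [C hC] := wave_decay th G.
apply: (L1_dominated _ (L1Z C (L1_oneDsqrV R)) hC).
by apply: continuous_measurable_fun; exact/continuous_wave/(decay_upto_L1 G).
Qed.

End Schwartz.

(** * Smooth plateaus *)


Section Plateau.
Variable R : realType.
Implicit Types (f g : R -> R) (a b x t h : R) (p : {poly R}).
Local Notation mu := (@lebesgue_measure R).

(** The analogue of [decay_upto] without growth conditions, which constants and affine maps would
    violate; compact support later turns it into [decay_upto]. *)
Fixpoint smooth_upto (n : nat) f : Prop :=
  continuous f /\
  if n is n'.+1 then
    exists2 f' : R -> R, (forall x, is_derive x 1 f (f' x)) & smooth_upto n' f'
  else True.

Lemma smooth_upto_continuous n f : smooth_upto n f -> continuous f.
Proof. by case: n => [|n] []. Qed.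

Lemma smooth_uptoW n f : smooth_upto n.+1 f -> smooth_upto n f.
Proof.
elim: n f => [|n IH] f /= [F [f' df [F' H]]]; split => //.
by exists f' => //; apply: IH.
Qed.

Lemma smooth_upto_cst n a : smooth_upto n (fun=> a).
Proof.
elim: n a => [|n IH] a /=; (split; first exact: cst_continuous) => //.
by exists (fun=> 0) => // x; exact: is_derive_cst.
Qed.

Lemma smooth_upto_affine n a b : smooth_upto n (fun x => a * x - b).
Proof.
case: n => [|n] /=; split; try by
  apply: (@is_derive_continuous _ _ (fun=> a)) => x; exact: is_derive_affine.
  by [].
exists (fun=> a); last exact: smooth_upto_cst.
by move=> x; exact: is_derive_affine.
Qed.

Lemma smooth_uptoD n f g : smooth_upto n f -> smooth_upto n g ->
  smooth_upto n (fun x => f x + g x).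
Proof.
elim: n f g => [|n IH] f g /=; move=> [F H] [G K]; split;
  try by move=> x; apply: cvgD; [exact: F|exact: G].
  by [].
case: H => f' df Hf'; case: K => g' dg Kg'.
exists (fun x => f' x + g' x); last exact: IH.
by move=> x; exact: (is_deriveD (df x) (dg x)).
Qed.

Lemma smooth_uptoM n f g : smooth_upto n f -> smooth_upto n g ->
  smooth_upto n (fun x => f x * g x).
Proof.
elim: n f g => [|n IH] f g F G; (split;
  first by move=> x; apply: cvgM; [exact: (smooth_upto_continuous F)|exact: (smooth_upto_continuous G)]).
  by [].
have [_ [f' df Hf']] := F; have [_ [g' dg Kg']] := G.
exists (fun x => f x * g' x + g x * f' x).
  by move=> x; exact: (is_deriveM (df x) (dg x)).
by apply: smooth_uptoD; apply: IH => //; exact: smooth_uptoW.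
Qed.

Lemma smooth_upto_comp n f g : smooth_upto n f -> smooth_upto n g ->
  smooth_upto n (fun x => f (g x)).
Proof.
elim: n f g => [|n IH] f g F G; (split; first by
  move=> x; apply: continuous_comp; [exact: (smooth_upto_continuous G)|exact: (smooth_upto_continuous F)]).
  by [].
have [_ [f' df Hf']] := F; have [_ [g' dg Kg']] := G.
exists (fun x => f' (g x) * g' x).
  by move=> x; exact: (is_derive1_comp (df (g x)) (dg x)).
by apply: smooth_uptoM => //; apply: IH => //; exact: smooth_uptoW.
Qed.

Lemma pow_le_expR (n : nat) (y : R) : 0 <= y -> y ^+ n <= n`!%:R * expR y.
Proof.
case: n => [|n] y0; first by rewrite expr0 mul1r -(@expR0 R) ler_expR.
have := expR_ge1Dxn n y0 => h.
have f0 : 0 < (n.+1)`!%:R :> R by rewrite ltr0n fact_gt0.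
rewrite mulrC -ler_pdivrMr// (le_trans _ h)// lerDr//.
Qed.

Lemma poly_expR_bounded p : exists2 C : R, 0 <= C &
  forall y, 0 <= y -> `|p.[y] * expR (- y)| <= C.
Proof.
exists (\sum_(i < size p) `|p`_i| * (i`!)%:R).
  by apply: sumr_ge0 => i _; rewrite mulr_ge0.
move=> y y0; rewrite normrM (ger0_norm (expR_ge0 _)) expRN ler_pdivrMr ?expR_gt0//.
rewrite horner_coef (le_trans (ler_norm_sum _ _ _))// mulr_suml ler_sum// => i _.
rewrite normrM -mulrA ler_wpM2l// ger0_norm ?exprn_ge0//.
exact: pow_le_expR.
Qed.

Lemma is_derive_quadratic f (C : R) : f 0 = 0 -> (forall h, `|f h| <= C * h ^+ 2) ->
  is_derive (0 : R) 1 f 0.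
Proof.
move=> f0 fC.
have C0 : 0 <= C by have := le_trans (normr_ge0 _) (fC 1); rewrite expr1n mulr1.
have c : h^-1 *: ((f \o shift 0) (h *: 1) - f 0) @[h --> 0^'] --> (0 : R).
  apply/cvgrPdist_le => e e0; near=> h.
  rewrite sub0r normrN /= addr0 f0 subr0 -[_ *: _]/(_ * _) -[h *: 1]/(h * 1) mulr1.
  have h0 : h != 0 by near: h; exact: nbhs_dnbhs_neq.
  rewrite normrM normfV mulrC ler_pdivrMr ?normr_gt0//.
  apply: (le_trans (fC h)).
  rewrite -real_normK ?num_real// expr2 mulrA ler_wpM2r//.
  have : `|h| <= e / (C + 1).
    near: h; apply: dnbhs0_le; rewrite divr_gt0//.
    by rewrite ltr_wpDl.
  rewrite ler_pdivlMr; last by rewrite ltr_wpDl.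
  by have := normr_ge0 h; lra.
apply: DeriveDef; first by apply/cvg_ex; exists 0.
by rewrite /derive; exact: cvg_lim c.
Unshelve. all: by end_near. Qed.

Lemma near_is_derive f g x (d : R) : (forall y, `|y - x| < `|x| -> f y = g y) ->
  x != 0 -> is_derive x 1 f d -> is_derive x 1 g d.
Proof.
move=> fg x0; apply: near_eq_is_derive; near=> y; apply: fg; near: y.
have := @cvgr_dist_lt _ _ _ (nbhs x) _ id x cvg_id `|x|.
rewrite normr_gt0 => /(_ _ x0); apply: filterS => y.
by rewrite distrC.
Unshelve. all: by end_near. Qed.

(** The functions [p(1/x) exp(-1/x)], extended by 0, form a class closed under differentiation, so
    smoothness follows by induction over all polynomials. *)
Definition flat p x : R := if 0 < x then p.[x^-1] * expR (- x^-1) else 0.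

Lemma is_derive_flat p x :
  is_derive x 1 (flat p) (flat ('X^2 * (p - p^`())) x).
Proof.
have [x0|x0|<-] := ltrgtP 0 x.
- rewrite {2}/flat x0.
  apply: (@near_is_derive (fun y => p.[y^-1] * expR (- y^-1))).
  - move=> y; rewrite (gtr0_norm x0) ltr_norml => /andP[xy _].
    by rewrite /flat ifT//; lra.
  - by rewrite gt_eqF.
  have x0' : x != 0 by rewrite gt_eqF.
  have dV : is_derive x 1 (fun y : R => y^-1) (- x ^- 2).
    by apply: (is_derive_eq (@is_deriveV _ id x 1 1 x0' (is_derive_id _ _))); rewrite -[_ *: _]/(_ * _) mulr1.
  have dp := @is_derive1_comp _ (horner p) (fun y => y^-1) x _ _ (is_derive_poly p x^-1) dV.
  have dE := @is_derive1_comp _ (@expR R) (fun y => - y^-1) x _ _ (is_derive_expR _) (is_deriveN dV).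
  apply: (is_derive_eq (is_deriveM dp dE)).
  rewrite -![_ *: _]/(_ * _) hornerM hornerXn hornerD hornerN /=.
  by rewrite exprVn; ring.
- rewrite {2}/flat lt_gtF//.
  apply: (near_is_derive _ _ (is_derive_cst (0 : R) x 1)).
  - move=> y; rewrite (ltr0_norm x0) ltr_norml => /andP[_ xy].
    by rewrite /flat ifF//; apply: lt_gtF; lra.
  - by rewrite lt_eqF.
- rewrite {2}/flat ltxx.
  (* Boundedness of [y ^ 2 p(y) exp(-y)], taken at [y = 1/h], reads [|flat p h| <= C h ^ 2], which
     forces derivative 0 at the origin. *)
  have [C C0 hC] := poly_expR_bounded ('X^2 * p).
  apply: (@is_derive_quadratic _ C); first by rewrite /flat ltxx.
  move=> h; rewrite /flat; case: ifPn => h0; last first.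
    by rewrite normr0 mulr_ge0// sqr_ge0.
  have hV : 0 <= h^-1 by rewrite invr_ge0 ltW.
  have := hC _ hV; rewrite hornerM hornerXn -mulrA normrM.
  rewrite ger0_norm ?exprn_ge0// exprVn => /(ler_wpM2l (sqr_ge0 h)).
  by rewrite mulVKf ?expf_neq0 ?gt_eqF// [C * _]mulrC.
Qed.

Lemma smooth_upto_flat n p : smooth_upto n (flat p).
Proof.
elim: n p => [|n IH] p; (split; first exact: (is_derive_continuous (is_derive_flat p))).
  by [].
by exists (flat ('X^2 * (p - p^`()))) => // x; exact: is_derive_flat.
Qed.

Definition flat1 x : R := flat 1 x.

Lemma flat1_le0 x : x <= 0 -> flat1 x = 0.
Proof. by move=> x0; rewrite /flat1 /flat ltNge x0. Qed.

Lemma flat1_gt0 x : 0 < x -> 0 < flat1 x.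
Proof. by move=> x0; rewrite /flat1 /flat x0 hornerE mul1r expR_gt0. Qed.

Lemma flat1_ge1 x : 1 <= x -> flat1 1 <= flat1 x.
Proof.
move=> x1; rewrite /flat1 /flat ltr01 (lt_le_trans ltr01 x1) !hornerE.
by rewrite ler_expR lerN2 invr1 invf_le1// (lt_le_trans ltr01 x1).
Qed.

(** A composition in place of the usual quotient of flat functions: the inner difference is
    nonpositive for [x <= 0] and equal to [flat1 1] for [x >= 1]. The upper level is therefore
    [flat1 (flat1 1)] rather than 1. *)
Definition smooth_step x : R := flat1 (flat1 1 - flat1 (1 - x)).

Lemma smooth_step_le0 x : x <= 0 -> smooth_step x = 0.
Proof.
move=> x0; rewrite /smooth_step flat1_le0// subr_le0 flat1_ge1//.
by rewrite lerDl oppr_ge0.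
Qed.

Lemma smooth_step_ge1 x : 1 <= x -> smooth_step x = flat1 (flat1 1).
Proof.
by move=> x1; rewrite /smooth_step (@flat1_le0 (1 - x)) ?subr0// subr_le0.
Qed.

Lemma smooth_upto_step n : smooth_upto n smooth_step.
Proof.
apply: (@smooth_upto_comp n flat1 (fun x => flat1 1 - flat1 (1 - x))).
  exact: smooth_upto_flat.
rewrite (_ : (fun _ => _) = (fun x => flat1 1 + -1 * flat1 (-1 * x - (-1)))); last first.
  by apply/funext => x; rewrite !mulN1r opprK [- x + 1]addrC.
apply: smooth_uptoD; first exact: smooth_upto_cst.
apply: smooth_uptoM; first exact: smooth_upto_cst.
apply: (@smooth_upto_comp n flat1); first exact: smooth_upto_flat.
exact: smooth_upto_affine.
Qed.

(** Each [x ^ k * f x] attains a maximal absolute value on [[-A, A]] and vanishes outside. The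
    derivative inherits the support condition because [|x| > A] is open. *)
Lemma compact_support_decay n f (A : R) : 0 <= A ->
  (forall x, A < `|x| -> f x = 0) -> smooth_upto n f -> decay_upto n f.
Proof.
move=> A0; elim: n f => [|n IH] f fA F; (split; first
  (move=> k;
   have AA : - A <= A by [lra];
   have [|c _ hc] := @EVT_max R (fun x => `|x ^+ k * f x|) (- A) A AA;
   [ apply: continuous_subspaceT => x; apply: cvg_norm; apply: cvgM;
     [exact: exprn_continuous|exact: (smooth_upto_continuous F)]
   | exists `|c ^+ k * f c| => x; have [xA|xA] := leP `|x| A;
     [by apply: hc; rewrite in_itv/= -ler_norml|by rewrite fA// mulr0 normr0]])).
  by [].
have [_ [f' df Hf']] := F; exists f' => //; apply: IH => // x xA.
have dx0 : is_derive x 1 f 0.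
  apply: (near_eq_is_derive _ (is_derive_cst (0 : R) x 1)).
  near=> y; rewrite fA//; near: y.
  exact: (@cvgr_gt _ _ _ _ (fun y : R => `|y|) `|x| (cvg_norm cvg_id) A xA).
by rewrite -(@derive_val _ _ _ _ _ _ _ (df x)) (@derive_val _ _ _ _ _ _ _ dx0).
Unshelve. all: by end_near. Qed.

Lemma exists_smooth_plateau (A : R) : 0 <= A ->
  exists2 b : R -> R, (forall n, decay_upto n b) &
  exists2 k : R, 0 < k & forall x, `|x| <= A -> b x = k.
Proof.
move=> A0.
(* A step rising from [- (A + 1)] to [- A], times its mirror image. *)
exists (fun x => smooth_step (1 * x - (- (A + 1))) * smooth_step (-1 * x - (- (A + 1)))).
  move=> n; apply: (@compact_support_decay n _ (A + 1)); first by lra.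
    move=> x; rewrite mul1r mulN1r ltr_normr => /orP[h|h].
      by rewrite [X in _ * X]smooth_step_le0 ?mulr0//; lra.
    by rewrite smooth_step_le0 ?mul0r//; lra.
  by apply: smooth_uptoM; apply: (@smooth_upto_comp n smooth_step);
    [exact: smooth_upto_step|exact: smooth_upto_affine|
     exact: smooth_upto_step|exact: smooth_upto_affine].
have s1 : 0 < flat1 1 by apply: flat1_gt0.
exists (flat1 (flat1 1) ^+ 2); first by rewrite exprn_gt0// !flat1_gt0.
move=> x; rewrite ler_norml => /andP[h1 h2].
by rewrite !smooth_step_ge1 ?expr2//; lra.
Qed.

End Plateau.

(** * Band-limited real functions *)


Section RealBandLimited.
Variable R : realType.
Implicit Types (f g : R -> R) (a b x t s h th : R) (I : set R).
Local Notation mu := (@lebesgue_measure R).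

Lemma schwartz_real_L1 g : schwartz_real g -> L1 g.
Proof. by move=> /schwartz_decay_upto /(_ 1%N); exact: decay_upto_L1. Qed.

Lemma schwartz_real_L1_wave g th : schwartz_real g -> L1 (wave g th).
Proof. by move=> /schwartz_decay_upto /(_ 3%N); exact: L1_wave. Qed.

Lemma schwartz_real0 : schwartz_real (fun=> 0 : R).
Proof.
apply/schwartz_decay_upto => n; elim: n => [|n IH] /=; split => //;
  try by move=> k; exists 0 => x; rewrite mulr0 normr0.
by exists (fun=> 0) => // x; exact: is_derive_cst.
Qed.

Lemma wave0 th t : wave (fun=> 0 : R) th t = 0.
Proof. by rewrite /wave -[RHS](Rint_zero R); apply: eq_Rint => x; rewrite mulr0. Qed.

Lemma wave_phase g th t : L1 g ->
  wave g th t = cos th * wave g 0 t + sin th * wave g (pi / 2) t.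
Proof.
move=> lg; rewrite /wave -!RintZ -?RintD; try by [exact: L1_cosM|apply: L1Z; exact: L1_cosM].
apply: eq_Rint => x.
by rewrite cosB subr0 cosBpihalf; ring.
Qed.

Lemma fourier_Re (g : R -> R[i]) t :
  L1 (fun x => complex.Re (g x)) -> L1 (fun x => complex.Im (g x)) ->
  complex.Re (fourier g t) =
  wave (fun x => complex.Re (g x)) 0 t + wave (fun x => complex.Im (g x)) (pi / 2) t.
Proof.
move=> l1 l2; rewrite /= /wave -RintD; try exact: L1_cosM.
apply: eq_Rint => x; rewrite subr0 cosBpihalf.
by case: (g x) => u v /=; rewrite cosN sinN; ring.
Qed.

Lemma fourier_Im (g : R -> R[i]) t :
  L1 (fun x => complex.Re (g x)) -> L1 (fun x => complex.Im (g x)) ->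
  complex.Im (fourier g t) =
  wave (fun x => complex.Im (g x)) 0 t - wave (fun x => complex.Re (g x)) (pi / 2) t.
Proof.
move=> l1 l2; rewrite /= /wave -RintB; try exact: L1_cosM.
apply: eq_Rint => x; rewrite subr0 cosBpihalf.
by case: (g x) => u v /=; rewrite cosN sinN; ring.
Qed.

Definition null_off I g : Prop :=
  schwartz_real g /\ closure [set x | g x != 0] `&` I = set0.

(** For real [f] the real and imaginary parts of the pairing are combinations of integrals against
    waves of phase 0 and [pi / 2]. A real test function isolates these two phases, which generate
    all others; conversely the parts of a complex test function have no larger support. *)
Lemma band_limited_real I f (M : R) : continuous f -> (forall t, `|f t| <= M) ->
  band_limited I (fun t => (f t)%:C%C) <->
  forall g, null_off I g -> forall th, \int[mu]_t (f t * wave g th t) = 0.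
Proof.
move=> cf fM; have mf : measurable_fun [set: R] f by exact: continuous_measurable_fun.
have L1f (h : R -> R) : L1 h -> L1 (fun t => f t * h t) by exact: L1M_bounded.
have pairE (g : R -> R[i]) : schwartz_real (fun x => complex.Re (g x)) ->
    schwartz_real (fun x => complex.Im (g x)) ->
    fourier_pairing (fun t => (f t)%:C%C) g =
    ((\int[mu]_t (f t * wave (fun x => complex.Re (g x)) 0 t) +
      \int[mu]_t (f t * wave (fun x => complex.Im (g x)) (pi / 2) t)) +i*
     (\int[mu]_t (f t * wave (fun x => complex.Im (g x)) 0 t) -
      \int[mu]_t (f t * wave (fun x => complex.Re (g x)) (pi / 2) t)))%C.
  move=> s1 s2; have l1 := schwartz_real_L1 s1; have l2 := schwartz_real_L1 s2.
  rewrite -RintD -?RintB; try by apply: L1f; exact: schwartz_real_L1_wave.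
  rewrite /fourier_pairing /cintegral; congr (_ +i* _)%C; apply: eq_Rint => t.
    rewrite -mulrDr -fourier_Re//; case: (fourier g t) => u v /=.
    by rewrite mul0r subr0.
  rewrite -mulrBr -fourier_Im//; case: (fourier g t) => u v /=.
  by rewrite mul0r addr0.
split=> [[_ _ _ H] g [sg dg] th|H].
  have sg' : schwartz (fun x => (g x)%:C%C).
    by split => /=; [exact: sg|exact: schwartz_real0].
  have := H _ sg'; rewrite pairE//=; last exact: schwartz_real0.
  have -> : fsupport (fun x => (g x)%:C%C) = closure [set x | g x != 0].
    congr closure; apply/seteqP; split => x /=; apply: contra_neq.
      by move=> ->.
    by case.
  move=> /(_ dg) [].
  have E0 th' : \int[mu]_t (f t * wave (fun=> 0 : R) th' t) = 0.
    by rewrite -[RHS](Rint_zero R); apply: eq_Rint => t; rewrite wave0 mulr0.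
  rewrite !E0 addr0 sub0r => E1 /eqP; rewrite oppr_eq0 => /eqP E2.
  transitivity (\int[mu]_t (cos th * (f t * wave g 0 t) +
                            sin th * (f t * wave g (pi / 2) t))).
    apply: eq_Rint => t; rewrite (wave_phase th); last exact: schwartz_real_L1.
    by ring.
  have L1w th' : L1 (fun t => f t * wave g th' t).
    by apply: L1f; exact: schwartz_real_L1_wave.
  by rewrite RintD ?RintZ ?E1 ?E2 ?mulr0 ?addr0//; exact: L1Z.
split => //=.
- exact: cst_continuous.
- exists M => t; rewrite normc_def/= expr0n addr0 sqrtr_sqr.
  by rewrite lecE/= eqxx fM.
- move=> g [s1 s2] dg; rewrite pairE//.
  have n1 : null_off I (fun x => complex.Re (g x)).
    split => //; rewrite -subset0 => x [x1 x2]; rewrite -dg; split => //.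
    apply: closure_subset x1 => y /=.
    by apply: contra_neq => ->.
  have n2 : null_off I (fun x => complex.Im (g x)).
    split => //; rewrite -subset0 => x [x1 x2]; rewrite -dg; split => //.
    apply: closure_subset x1 => y /=.
    by apply: contra_neq => ->.
  by rewrite !H// addr0 subr0.
Qed.

Lemma band_spaceP I f : band_space I f <->
  [/\ continuous f, forall t, `|f t| <= 1 &
  forall g, null_off I g -> forall th, \int[mu]_t (f t * wave g th t) = 0].
Proof.
split=> [[b f1]|[cf f1 H]].
  have cf : continuous f by case: b => + _ _ _; apply.
  by split => //; apply/(band_limited_real I cf f1).
by split => //; apply/(band_limited_real I cf f1).
Qed.

Lemma null_off_cosM I g a b : null_off I g ->
  null_off I (fun x => cos (a * x - b) * g x).
Proof.
move=> [sg dg]; split.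
  apply/schwartz_decay_upto => n; apply: decay_upto_cosM.
  by move/schwartz_decay_upto: sg; exact.
rewrite -subset0 => x [x1 x2]; rewrite -dg; split => //.
by apply: closure_subset x1 => y /=; rewrite mulf_eq0 negb_or => /andP[].
Qed.

Lemma Rint_translate f (M : R) s (k : R -> R) : continuous f ->
  (forall t, `|f t| <= M) -> L1 k ->
  \int[mu]_t (f (t + s) * k t) = \int[mu]_t (f t * k (t - s)).
Proof.
move=> cf fM lk.
have lF : L1 (fun t => f t * k (t - s)).
  apply: (L1M_bounded _ fM); first exact: continuous_measurable_fun.
  exact: L1_shift.
rewrite -(Rint_shift s lF); apply: eq_Rint => t.
by rewrite addrK.
Qed.

(** The shift moves to the transform of the test function, where it is a modulation, and modulating
    keeps a test function null off the same set. *)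
Lemma band_space_translate I f s : band_space I f -> band_space I (translate s f).
Proof.
move=> /band_spaceP[cf f1 H]; apply/band_spaceP; split.
- move=> t; apply: (@continuous_comp _ _ _ (fun t => t + s) f); last exact: cf.
  by apply: cvgD; [exact: cvg_id|exact: cvg_cst].
- by move=> t; exact: f1.
move=> g Ng th; have [sg _] := Ng.
have mf : measurable_fun [set: R] f by exact: continuous_measurable_fun.
rewrite /translate (Rint_translate _ cf f1); last exact: schwartz_real_L1_wave.
have lg := schwartz_real_L1 sg.
transitivity (\int[mu]_t (f t * wave (fun x => cos (2 * pi * s * x - 0) * g x) th t +
  f t * wave (fun x => cos (2 * pi * s * x - pi / 2) * g x) (th + pi / 2) t)).
  by apply: eq_Rint => t; rewrite wave_translate// mulrDr.
rewrite RintD; last 2 first.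
- apply: (L1M_bounded mf f1); apply: schwartz_real_L1_wave.
  by have [] := null_off_cosM (2 * pi * s) 0 Ng.
- apply: (L1M_bounded mf f1); apply: schwartz_real_L1_wave.
  by have [] := null_off_cosM (2 * pi * s) (pi / 2) Ng.
by rewrite !H ?addr0//; exact: null_off_cosM.
Qed.

Lemma measurable_cos2 a b :
  measurable_fun [set: R * R] (fun z => cos (a * z.1 * z.2 - b)).
Proof.
have mc : measurable_fun [set: R] (fun x => cos (x - b)).
  by have := measurable_cos_affine 1 b; congr measurable_fun; apply/funext => x; rewrite mul1r.
apply: (measurableT_comp mc).
apply: measurable_funM; last exact: measurable_snd.
by apply: measurable_funM => //; exact: measurable_fst.
Qed.

Lemma continuous_tent : continuous (@tent R).
Proof.
move=> x; apply: cvgB; last by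
  apply: cvgM; [apply: cvg_norm; exact: cvg_id|exact: cvg_cst].
apply: cvgD; (apply: cvgM; last exact: cvg_cst);
  apply: cvg_norm; apply: cvgD => //; exact: cvg_cst.
Qed.

Lemma tent_le1 x : tent x <= 1.
Proof.
rewrite /tent; have h1 := ler_normD x 2; have h2 := ler_normB x 2.
by rewrite (@ger0_norm _ 2)// in h1 h2; lra.
Qed.

Lemma tent_ge_half x : `|x| <= 1 -> 1 / 2 <= tent x.
Proof.
rewrite ler_norml => /andP[x1 x2].
have h : `|x| <= 1 by rewrite ler_norml x1.
by rewrite /tent (@ger0_norm _ (x + 2)) ?(@ler0_norm _ (x - 2)); lra.
Qed.

Lemma L1_tent a : 0 < a -> L1 (fun x => tent (a * x)).
Proof.
move=> a0; apply: (L1_scale a0).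
(* The tent is at most 1, and [1 + x ^ 2 <= 5] on its support [[-2, 2]]. *)
apply: (L1_dominated _ (L1Z 5 (L1_oneDsqrV R))).
  by apply: continuous_measurable_fun; exact: continuous_tent.
move=> x; rewrite ger0_norm ?tent_ge0//.
have p1 : 0 < 1 + x ^+ 2 by rewrite ltr_pwDl// sqr_ge0.
have [x2|x2] := lerP 2 `|x|.
  by rewrite tent_eq0// mulr_ge0// invr_ge0 ltW.
rewrite (le_trans (tent_le1 x))// ler_pdivlMr// mul1r.
have : `|x| ^+ 2 <= 2 ^+ 2 by rewrite lerXn2r// ?nnegrE// ltW.
by rewrite real_normK ?num_real//; lra.
Qed.

(* The multiplication formula against dilated Fejer kernels: the Fourier
   transform of such a kernel is a tent inside the region where [b] equals [k]. *)
Lemma Rint_wave_gt0 (A : R) (b : R -> R) (k : R) : 0 < A ->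
  (forall n, decay_upto n b) -> 0 < k -> (forall x, `|x| <= A -> b x = k) ->
  0 < \int[mu]_t wave b 0 t.
Proof.
move=> A0 hb k0 bk.
have lb := decay_upto_L1 (hb 1%N).
have lw : L1 (wave b 0) by exact: L1_wave.
have pi0 := pi_gt0 R.
pose T := \int[mu]_x tent (2 * pi * x).
have T0 : 0 < T.
  apply: (@Rint_gt0 _ _ 0 (2 * pi)^-1 (1 / 2)) => //.
  - by rewrite invr_gt0 mulr_gt0.
  - by apply: L1_tent; rewrite mulr_gt0.
  - by move=> x; exact: tent_ge0.
  - move=> x x0 x1; apply: tent_ge_half; rewrite ger0_norm; last by rewrite !mulr_ge0// ltW.
    by rewrite mulrC -ler_pdivlMr ?mulr_gt0// mul1r.
(* The transform of the dilated kernel is supported in [|x| <= e / pi], which the condition on [e]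
   places inside [[-A, A]]. *)
have E (e : R) : 0 < e -> e <= pi * A ->
    \int[mu]_t (wave b 0 t * sinc2 (e * t)) = fejer_mass R * k * T.
  move=> e0 eA.
  have ls : L1 (fun t => sinc2 (e * t)) by apply: L1_scale => //; exact: L1_sinc2.
  transitivity (\int[mu]_t (sinc2 (e * t) *
      \int[mu]_x (cos (2 * pi * (t, x).1 * (t, x).2 - 0) * b x))).
    by apply: eq_Rint => t; rewrite mulrC.
  rewrite (@Rint_swapM _ (fun z => cos (2 * pi * z.1 * z.2 - 0)) _ _ _ _ ls lb).
  - have Ex x : b x * \int[mu]_t (cos (2 * pi * x * t - 0) * sinc2 (e * t)) =
        k * fejer_mass R * e^-1 * tent (2 * pi * (e^-1 * x)).
      rewrite (_ : \int[mu]_t _ = e^-1 * (tent (2 * pi * (e^-1 * x)) * fejer_mass R)).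
        have [xA|xA] := leP `|x| A; first by rewrite bk//; ring.
        rewrite tent_eq0 ?mul0r ?mulr0//.
        rewrite !normrM (@ger0_norm _ 2)// (gtr0_norm pi0) (@gtr0_norm _ e^-1) ?invr_gt0//.
        rewrite -mulrA ler_peMr// mulrCA ler_pdivlMl// mulr1.
        by rewrite (le_trans eA)// ler_wpM2l// ltW.
      rewrite -[tent _]mul1r -(@cos0 R) -Rint_sinc2_cos -Rint_scale//; last exact: L1_sinc2_cos.
      by apply: eq_Rint => t; congr (cos _ * _); field; rewrite gt_eqF.
    transitivity (\int[mu]_x (k * fejer_mass R * e^-1 * tent (2 * pi * (e^-1 * x)))).
      apply: eq_Rint => x; rewrite -Ex; congr (_ * _); apply: eq_Rint => t /=.
      by congr (cos _ * _); ring.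
    have lt : L1 (fun x => tent (2 * pi * x)) by apply: L1_tent; rewrite mulr_gt0.
    have e0' : 0 < e^-1 by rewrite invr_gt0.
    rewrite RintZ; last exact: (L1_scale e0' lt).
    rewrite (Rint_scale e0' lt) invrK -/T.
    by field; rewrite gt_eqF.
  - exact: measurable_cos2.
  - by move=> z; exact: cos_max.
pose e n : R := pi * A * n.+1%:R^-1.
have lim : \int[mu]_t (wave b 0 t * sinc2 (e n * t)) @[n --> \oo] -->
    \int[mu]_t (wave b 0 t * (t != 0)%:R).
  apply: (@Rint_dominated_cvg _ _ _ (fun t => `|wave b 0 t|)).
  - move=> n; apply: measurable_funM; first exact: (L1_measurable lw).
    apply: measurableT_comp; first exact: (L1_measurable (L1_sinc2 R)).
    exact: measurable_funM.
  - move=> t; apply: cvgM; first exact: cvg_cst.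
    have [->|t0] := eqVneq t 0.
      rewrite (_ : (fun _ => _) = fun=> 0); first exact: cvg_cst.
      by apply/funext => n; rewrite mulr0 /sinc2 sin0 expr0n mul0r.
    rewrite /=.
    have en0 n : e n != 0 by rewrite gt_eqF// !mulr_gt0// invr_gt0.
    apply: (@squeeze_cvgr _ _ _ _ (fun n => 1 - (e n * t) ^+ 2) (fun=> 1)).
    - by apply: nearW => n; apply: sinc2_bounds; rewrite mulf_neq0.
    - rewrite -[X in _ --> X]subr0; apply: cvgB; first exact: cvg_cst.
      rewrite (_ : (0 : R) = 0 ^+ 2); last by rewrite expr0n.
      apply: (@cvg_comp _ _ _ (fun n => e n * t) (fun x => x ^+ 2) _ (nbhs (0 : R))); last exact: exprn_continuous.
      rewrite -(mul0r t); apply: cvgM; last exact: cvg_cst.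
      rewrite -(mulr0 (pi * A)); apply: cvgM; first exact: cvg_cst.
      exact: cvg_harmonic.
    - exact: cvg_cst.
  - exact: L1_norm.
  - move=> n t; rewrite normrM ler_piMr//.
    rewrite ger0_norm ?sinc2_ge0//.
    have [->|h0] := eqVneq (e n * t) 0; first by rewrite /sinc2 sin0 expr0n mul0r.
    by have /andP[] := sinc2_bounds h0.
move: lim; rewrite Rint_neq0; last exact: (L1_measurable lw).
have -> : (fun n => \int[mu]_t (wave b 0 t * sinc2 (e n * t))) =
    (fun=> fejer_mass R * k * T).
  apply/funext => n; apply: E; first by rewrite !mulr_gt0// ?invr_gt0.
  apply: ler_piMr; first by rewrite mulr_ge0 ?ltW.
  by rewrite invf_le1 ?ler1n ?ltr0n.
move=> /(cvg_unique (@Rhausdorff R) (cvg_cst _)) <-.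
by rewrite !mulr_gt0// fejer_mass_gt0.
Qed.

End RealBandLimited.

(** * Compactness of the band spaces *)


Section BandCompact.
Variable R : realType.
Implicit Types (f g w : R -> R) (a b x y t s h th A c : R) (I : set R).
Local Notation mu := (@lebesgue_measure R).

(* If [b] is constant near [I] then [b - b (e * _)] vanishes there for [e <= 1],
   so [f] pairs equally with the transforms of [b] and of [b (e * _)]; the
   latter concentrate at [0] as [e] tends to [0]. *)
Lemma reproducing_kernel I A : 0 < A -> (forall x, I x -> `|x| <= A) ->
  exists w : R -> R, exists2 c : R, 0 < c &
    [/\ continuous w, L1 w,
        exists C : R, forall t, `|w t| <= C * (1 + t ^+ 2)^-1 &
        forall f, band_space I f -> forall x,
          c * f x = \int[mu]_t (f t * w (t - x))].
Proof.
move=> A0 IA.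
(* The plateau reaches to [A + 1], so the closed support of [b - b (e * _)], contained in
   [|x| >= A + 1], misses [I]. *)
have A1 : 0 < A + 1 by lra.
have [b hb [k k0 bk]] := exists_smooth_plateau (ltW A1).
have lb := decay_upto_L1 (hb 1%N).
have lw := L1_wave 0 (hb 3%N).
exists (wave b 0), (\int[mu]_t wave b 0 t).
  exact: (Rint_wave_gt0 A1 hb k0 bk).
split => //; first exact: continuous_wave.
  exact: wave_decay.
have null (e : R) : 0 < e -> e <= 1 -> null_off I (fun x => b x - b (e * x)).
  move=> e0 e1; split.
    apply/schwartz_decay_upto => n; apply: decay_uptoB => //.
    exact: decay_upto_scale.
  rewrite -subset0 => x [x1 x2].
  have : [set x | A + 1 <= `|x|] x.
    apply: (closed_comp (f := fun x : R => `|x|) _ (@closed_ge R (A + 1))); last first.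
      apply: closure_subset x1 => y /=; apply: contra_neqP.
      move=> /negP; rewrite -ltNge => /ltW yA; rewrite !bk ?subrr//.
      by rewrite normrM gtr0_norm// (le_trans _ yA)// ler_piMl.
    by move=> y _; exact: norm_continuous.
  by have := IA _ x2; rewrite /=; lra.
have at0 f : band_space I f -> f 0 * \int[mu]_t wave b 0 t = \int[mu]_t (f t * wave b 0 t).
  move=> /band_spaceP[cf f1 H].
  have mf : measurable_fun [set: R] f by exact: continuous_measurable_fun.
  have E n : \int[mu]_t (f (n.+1%:R^-1 * t) * wave b 0 t) = \int[mu]_t (f t * wave b 0 t).
    have n0 : 0 < n.+1%:R :> R by rewrite ltr0n.
    have ni : 0 < n.+1%:R^-1 :> R by rewrite invr_gt0.
    have n1 : n.+1%:R^-1 <= 1 :> R by rewrite invf_le1// ler1n.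
    have lbe := L1_scale ni lb.
    have lwe : L1 (wave (fun x => b (n.+1%:R^-1 * x)) 0).
      by apply: L1_wave; exact: decay_upto_scale.
    have := H _ (null _ ni n1) 0.
    have -> : \int[mu]_t (f t * wave (fun x => b x - b (n.+1%:R^-1 * x)) 0 t) =
      \int[mu]_t (f t * wave b 0 t - f t * wave (fun x => b (n.+1%:R^-1 * x)) 0 t).
      by apply: eq_Rint => t; rewrite waveB// mulrBr.
    rewrite RintB; try exact: (L1M_bounded mf f1).
    move/eqP; rewrite subr_eq0 => /eqP ->.
    (* The transform of the dilated plateau is a dilated transform, and a change of variables moves
       this dilation onto [f]. The right-hand side is then constant in [n], while the arguments of
       [f] tend to 0. *)
    pose F t := f (n.+1%:R^-1 * t) * wave b 0 t.
    have lF : L1 F.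
      apply: (@L1M_bounded _ 1) => //.
      by apply: measurableT_comp => //; exact: measurable_funM.
    transitivity (\int[mu]_t (n.+1%:R * F (n.+1%:R * t))).
      rewrite RintZ; last exact: L1_scale.
      by rewrite Rint_scale// mulVKf// gt_eqF.
    apply: eq_Rint => t; rewrite wave_scale// invrK /F mulKf ?gt_eqF//.
    by ring.
  have : \int[mu]_t (f (n.+1%:R^-1 * t) * wave b 0 t) @[n --> \oo] -->
     \int[mu]_t (f 0 * wave b 0 t).
    apply: (@Rint_dominated_cvg _ _ _ (fun t => `|wave b 0 t|)).
    - move=> n; apply: measurable_funM; last exact: (L1_measurable lw).
      by apply: measurableT_comp => //; exact: measurable_funM.
    - move=> t; apply: cvgM; last exact: cvg_cst.
      apply: (@cvg_comp _ _ _ (fun n : nat => n.+1%:R^-1 * t) f _ (nbhs (0 : R))); last exact: cf.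
      rewrite -(mul0r t); apply: cvgM; last exact: cvg_cst.
      exact: cvg_harmonic.
    - exact: L1_norm.
    - by move=> n t; rewrite normrM ler_piMl.
  rewrite (_ : (fun n : nat => _) = (fun=> \int[mu]_t (f t * wave b 0 t))); last exact/funext.
  by move=> /(cvg_unique (@Rhausdorff R) (cvg_cst _)) ->; rewrite RintZ.
(* Translation invariance of the band space carries the identity from 0 to [x]. *)
move=> f bf x; have /band_spaceP[cf f1 _] := bf.
rewrite -(Rint_translate x cf f1 lw) mulrC.
by have := at0 _ (band_space_translate x bf); rewrite /translate add0r.
Qed.

(** Continuity of translation in the integral norm, by dominated convergence along a sequence. From
    the index [N] on, [u n] is within 1 of [x], so both translates are dominated by multiples of one
    function, with constant [4 C = C + 3 C]. *)
Lemma Rint_translate_continuous w x : continuous w ->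
  (exists C : R, forall t, `|w t| <= C * (1 + t ^+ 2)^-1) ->
  \int[mu]_t `|w (t - x) - w (t - y)| @[y --> x] --> (0 : R).
Proof.
move=> cw [C hC]; apply/(@cvg_nbhsP _ R^o) => u ux.
have C0 : 0 <= C.
  by have := le_trans (normr_ge0 _) (hC 0); rewrite expr0n addr0 invr1 mulr1.
have [N _ uN] : \forall n \near \oo, `|x - u n| <= 1.
  by have /cvgrPdist_le := ux; apply.
rewrite -(cvg_shiftn N).
have E0 : \int[mu]_t `|w (t - x) - w (t - x)| = 0.
  by rewrite -[RHS](Rint_zero R); apply: eq_Rint => t; rewrite subrr normr0.
suff : \int[mu]_t `|w (t - x) - w (t - u (n + N)%N)| @[n --> \oo] -->
  \int[mu]_t `|w (t - x) - w (t - x)| by rewrite E0.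
have mw y : measurable_fun [set: R] (fun t => w (t - y)).
  apply: continuous_measurable_fun => t; apply: continuous_comp; last exact: cw.
  by apply: cvgB; [exact: cvg_id|exact: cvg_cst].
apply: (@Rint_dominated_cvg _ _ _ (fun t => 4 * C * (1 + (t - x) ^+ 2)^-1)).
- by move=> n; apply: measurableT_comp => //; exact: measurable_funB.
- move=> t; apply: cvg_norm; apply: cvgB; first exact: cvg_cst.
  apply: continuous_cvg; first exact: cw.
  by apply: cvgB; [exact: cvg_cst|rewrite (cvg_shiftn N)].
- by apply: L1Z; apply: (L1_shift (- x) (L1_oneDsqrV R)).
- move=> n t; rewrite normr_id (le_trans (ler_normB _ _))//.
  have h1 := hC (t - x).
  have h2 : `|w (t - u (n + N)%N)| <= C * (3 * (1 + (t - x) ^+ 2)^-1).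
    rewrite (le_trans (hC _))// ler_wpM2l//; apply: oneDsqrV_near.
    rewrite (_ : t - x - _ = - (x - u (n + N)%N)); last by ring.
    by rewrite normrN; apply: uN; exact: leq_addl.
  by lra.
Qed.

Definition bounded_band I : Prop := exists2 A : R, 0 < A & forall x, I x -> `|x| <= A.

(** By the reproducing identity and [|f| <= 1], the quantity [c * |f x - f y|] is at most the
    integral of [|w (t - x) - w (t - y)|], a bound independent of [f]. *)
Lemma band_space_near I x (e : R) : bounded_band I -> 0 < e ->
  \forall y \near x, forall f, band_space I f -> `|f x - f y| <= e.
Proof.
move=> [A A0 IA] e0; have [w [c c0 [cw lw wC Hw]]] := reproducing_kernel A0 IA.
have /cvgrPdist_le := @Rint_translate_continuous w x cw wC.
move=> /(_ (c * e)); rewrite mulr_gt0// => /(_ isT).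
apply: filterS => y; rewrite sub0r normrN => hy f bf.
rewrite -(ler_pM2l c0) (le_trans _ hy)// -{1}(gtr0_norm c0) -normrM mulrBr !Hw//.
have /band_spaceP[cf f1 _] := bf.
have mf : measurable_fun [set: R] f by exact: continuous_measurable_fun.
have lwx z : L1 (fun t => w (t - z)) by exact: L1_shift.
rewrite -RintB; try exact: (L1M_bounded mf f1).
rewrite [leRHS]ger0_norm; last exact: Rintegral_ge0.
apply: Rint_norm_le.
- by apply: L1_measurable; apply: L1B; exact: (L1M_bounded mf f1).
- by apply: L1_norm; exact: L1B.
- by move=> t; rewrite -mulrBr normrM ler_piMl.
Qed.

Lemma band_space_equicontinuous I : bounded_band I ->
  equicontinuous (band_space I : set (R -> R)) id.
Proof.
move=> bI x E; rewrite -entourage_ballE => -[e /= e0 eE].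
have := band_space_near x bI (divr_gt0 e0 (ltr0Sn R 1)).
apply: filterS => y H f bf; apply: eE => /=.
rewrite /ball/= (le_lt_trans (H f bf))// ltr_pdivrMr//; lra.
Qed.

(** Approximating within [1 / (n + 1)] on [[-n, n]] replaces the closure by a sequence, to which
    dominated convergence applies. *)
Lemma closure_band_space_seq I f : closure (band_space I) f ->
  exists2 g_ : nat -> R -> R, (forall n, band_space I (g_ n)) &
    forall x, g_ n x @[n --> \oo] --> f x.
Proof.
move=> cf.
have H (n : nat) : exists g, band_space I g /\
    forall x, `|x| <= n%:R -> `|f x - g x| < n.+1%:R^-1.
  have cK : compact (`[- n%:R, n%:R] : set R) by exact: segment_compact.
  have n0 : 0 < n.+1%:R^-1 :> R by rewrite invr_gt0.
  have [g [bg gE]] := cf _ (fam_nbhs f (entourage_ball R (PosNum n0)) cK).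
  exists g; split => // x xn; apply: gE => /=.
  by rewrite in_itv/= -ler_norml.
have [g_ Hg] := choice H; exists g_; first by move=> n; have [] := Hg n.
move=> x; apply/cvgrPdist_lt => e e0.
near=> n; have [_ h] := Hg n; apply: (lt_trans (h x _)).
  near: n; exists (Num.truncn `|x|).+1 => // n /= hn.
  by rewrite (le_trans (ltW (truncnS_gt _)))// ler_nat.
near: n.
have := @cvg_harmonic R => /cvgrPdist_lt /(_ e e0); apply: filterS => n.
by rewrite sub0r normrN ger0_norm// invr_ge0.
Unshelve. all: by end_near. Qed.

(** Continuity of the limit comes from equicontinuity, and the vanishing pairings pass to the limit
    because transforms of test functions are integrable. *)
Lemma closed_band_space I : bounded_band I -> closed (band_space I).
Proof.
move=> bI f /closure_band_space_seq [g_ bg gf]; apply/band_spaceP; split.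
- move=> x; apply/cvgrPdist_le => e e0.
  have := band_space_near x bI e0; apply: filterS => y H.
  apply: (@closed_cvg _ _ \oo _ (fun n => `|g_ n x - g_ n y|) [set z : R | z <= e]).
  + exact: closed_le.
  + by apply: nearW => n; exact: H.
  + by apply: cvg_norm; apply: cvgB.
- move=> t; apply: (@closed_cvg _ _ \oo _ (fun n => `|g_ n t|) [set z : R | z <= 1]).
  + exact: closed_le.
  + by apply: nearW => n /=; have /band_spaceP[_ + _] := bg n; exact.
  + exact: cvg_norm.
- move=> g Ng th; have lg := schwartz_real_L1_wave th Ng.1.
  have : \int[mu]_t (g_ n t * wave g th t) @[n --> \oo] --> \int[mu]_t (f t * wave g th t).
    apply: (@Rint_dominated_cvg _ _ _ (fun t => `|wave g th t|)).
    + move=> n; apply: measurable_funM; last exact: L1_measurable.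
      by apply: continuous_measurable_fun; have /band_spaceP[] := bg n.
    + by move=> t; apply: cvgM; [exact: gf|exact: cvg_cst].
    + exact: L1_norm.
    + by move=> n t; rewrite normrM ler_piMl//; have /band_spaceP[_ + _] := bg n; exact.
  rewrite (_ : (fun n : nat => _) = (fun=> 0)).
    by move=> /(cvg_unique (@Rhausdorff R) (cvg_cst _)).
  by apply/funext => n; have /band_spaceP[_ _] := bg n; apply.
Qed.

(** Arzela-Ascoli: equicontinuity and the bound 1 give precompactness, and the set is closed. *)
Lemma compact_band_space I : bounded_band I -> compact (band_space I).
Proof.
move=> bI; rewrite (closure_id (band_space I)).1; last exact: closed_band_space.
rewrite -precompactE; apply: pointwise_precompact_equicontinuous.
- exact: Rhausdorff.
- move=> x; apply: (@precompact_subset _ _ (`[-1, 1]%classic : set R)).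
    by move=> _ [f [_ f1] <-] /=; rewrite in_itv/= -ler_norml.
  by apply: compact_precompact; [exact: Rhausdorff|exact: segment_compact].
- exact: band_space_equicontinuous.
Qed.

End BandCompact.

(** * Convolution with modulated Fejer kernels *)


Section Smear.
Variable R : realType.
Implicit Types (f g w : R -> R) (a b x y t s h th A c : R) (I : set R) (k n : nat).
Local Notation mu := (@lebesgue_measure R).

Definition fejer_kernel k x : R := cos (2 * k%:R * x) * sinc2 x.

(* The factor [6 / pi] turns the frequency [2 k] of the kernel into [k / 6]. *)
Definition smear k f t : R :=
  (fejer_mass R)^-1 * \int[mu]_x (f (t + 6 / pi * x) * fejer_kernel k x).

Lemma L1_fejer_kernel k : L1 (fejer_kernel k).
Proof.
have := L1_sinc2_cos (2 * k%:R : R) 0; congr L1.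
by apply/funext => x; rewrite subr0.
Qed.

Lemma fejer_kernel_le k x : `|fejer_kernel k x| <= sinc2 x.
Proof.
rewrite /fejer_kernel normrM (ger0_norm (sinc2_ge0 x)).
by rewrite ler_piMl ?sinc2_ge0// cos_max.
Qed.

Lemma measurable_shift_scale f t : continuous f ->
  measurable_fun [set: R] (fun x => f (t + 6 / pi * x)).
Proof.
move=> cf; apply: measurableT_comp; first exact: continuous_measurable_fun.
by apply: measurable_funD => //; exact: measurable_funM.
Qed.

Lemma smear_le1 k f t : continuous f -> (forall x, `|f x| <= 1) ->
  `|smear k f t| <= 1.
Proof.
move=> cf f1; have m0 := fejer_mass_gt0 R.
rewrite /smear normrM gtr0_norm ?invr_gt0// ler_pdivrMl// mulr1 -Rint_sinc2.
apply: Rint_norm_le (L1_sinc2 R) _.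
  apply: measurable_funM; first exact: measurable_shift_scale.
  exact: (L1_measurable (L1_fejer_kernel k)).
by move=> x; rewrite normrM (le_trans _ (fejer_kernel_le k x))// ler_piMl.
Qed.

Lemma continuous_smear k f : continuous f -> (forall x, `|f x| <= 1) ->
  continuous (smear k f).
Proof.
move=> cf f1 t; apply: cvgM; first exact: cvg_cst.
apply/(@cvg_nbhsP _ R^o) => u ut.
apply: (@Rint_dominated_cvg _ _ _ (fun x => `|fejer_kernel k x|)).
- move=> n; apply: measurable_funM; first exact: measurable_shift_scale.
  exact: (L1_measurable (L1_fejer_kernel k)).
- move=> x; apply: cvgM; last exact: cvg_cst.
  apply: continuous_cvg; first exact: cf.
  by apply: cvgD => //; exact: cvg_cst.
- exact/L1_norm/L1_fejer_kernel.
- by move=> n x; rewrite normrM ler_piMl.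
Qed.

Lemma wave_le g th t : L1 g -> `|wave g th t| <= \int[mu]_x `|g x|.
Proof.
move=> lg; apply: Rint_norm_le.
- exact: (L1_measurable (L1_cosM _ _ lg)).
- exact: L1_norm.
- by move=> x; rewrite normrM ler_piMl// cos_max.
Qed.

(* Fubini moves the convolution kernel onto the Fourier transform of the test
   function, where it becomes multiplication by the tents of [fejer_kernel k]. *)
Lemma Rint_fejer_kernel_wave k g th t : L1 g ->
  (forall x, g x != 0 -> 1 <= `|6 * x + k%:R| /\ 1 <= `|6 * x - k%:R|) ->
  \int[mu]_x (fejer_kernel k x * wave g th (t - 6 / pi * x)) = 0.
Proof.
move=> lg gk; have pi0 : pi != 0 :> R by rewrite gt_eqF// pi_gt0.
have lK := L1_fejer_kernel k.
pose phi (z : R * R) := cos (2 * pi * (t - 6 / pi * z.1) * z.2 - th).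
have mphi : measurable_fun [set: R * R] phi.
  apply: (measurableT_comp (f := @cos R)).
    by apply: continuous_measurable_fun; exact: continuous_cos.
  apply: measurable_funB => //; apply: measurable_funM; last exact: measurable_snd.
  apply: measurable_funM => //; apply: measurable_funB => //.
  by apply: measurable_funM => //; exact: measurable_fst.
rewrite -[LHS]/(\int[mu]_x (fejer_kernel k x * \int[mu]_y (phi (x, y) * g y))).
rewrite (Rint_swapM mphi _ lK lg); last by move=> z; exact: cos_max.
rewrite -[RHS](Rint_zero R); apply: eq_Rint => y.
have [->|y0] := eqVneq (g y) 0; first by rewrite mul0r.
have [h1 h2] := gk y y0.
(* The frequency 12 is [2 pi] times the dilation [6 / pi]. The resulting tents sit at [-2 (6 y - k)]
   and [-2 (6 y + k)], and they vanish exactly under the two assumed inequalities. *)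
rewrite (_ : \int[mu]_x (phi (x, y) * fejer_kernel k x) =
  \int[mu]_x (cos (- 12 * y * x - (th - 2 * pi * t * y)) *
     (cos (2 * k%:R * x) * sinc2 x))); last first.
  apply: eq_Rint => x; rewrite /phi /fejer_kernel/=; congr (cos _ * _).
  have e : pi * (6 / pi) = 6 :> R by rewrite mulrCA mulfV// mulr1.
  transitivity (2 * pi * t * y - 2 * (pi * (6 / pi)) * x * y - th); first by ring.
  by rewrite e; ring.
rewrite Rint_sinc2_modulated !tent_eq0 ?addr0 ?mulr0//.
  rewrite (_ : _ - _ = - (2 * (6 * y + k%:R))); last by ring.
  by rewrite normrN normrM ger0_norm// ler_peMr.
rewrite (_ : _ + _ = - (2 * (6 * y - k%:R))); last by ring.
by rewrite normrN normrM ger0_norm// ler_peMr.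
Qed.

(** Fubini is applied twice: after the first exchange a translation in [t] frees [f] from the
    convolution variable, and after the second the inner integral is that of
    [Rint_fejer_kernel_wave]. *)
Lemma Rint_smear_wave k f g th : continuous f -> (forall x, `|f x| <= 1) ->
  schwartz_real g ->
  (forall x, g x != 0 -> 1 <= `|6 * x + k%:R| /\ 1 <= `|6 * x - k%:R|) ->
  \int[mu]_t (smear k f t * wave g th t) = 0.
Proof.
move=> cf f1 sg gk.
have lg := schwartz_real_L1 sg; have lW := schwartz_real_L1_wave th sg.
have lK := L1_fejer_kernel k.
have cW : continuous (wave g th) by exact: continuous_wave.
have mf : measurable_fun [set: R] f by exact: continuous_measurable_fun.
pose phi (z : R * R) := f (z.1 + 6 / pi * z.2).
have mlin (c : R) : measurable_fun [set: R * R] (fun z : R * R => z.1 + c * z.2).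
  apply: measurable_funD; first exact: measurable_fst.
  by apply: measurable_funM => //; exact: measurable_snd.
have mphi : measurable_fun [set: R * R] phi by exact: measurableT_comp.
have lsw : L1 (fun t => wave g th t * \int[mu]_x (phi (t, x) * fejer_kernel k x)).
  have : L1 (fun t => fejer_mass R * (smear k f t * wave g th t)).
    apply/L1Z/(@L1M_bounded _ 1) => //.
      by apply: continuous_measurable_fun; exact: continuous_smear.
    by move=> t; exact: smear_le1.
  congr L1; apply/funext => t; rewrite /smear /phi/=.
  by rewrite -mulrA mulVKf ?gt_eqF ?fejer_mass_gt0// mulrC.
transitivity ((fejer_mass R)^-1 *
    \int[mu]_t (wave g th t * \int[mu]_x (phi (t, x) * fejer_kernel k x))).
  rewrite -RintZ//; apply: eq_Rint => t; rewrite /smear /phi/=.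
  by rewrite -mulrA; congr (_ * _); rewrite mulrC.
rewrite (Rint_swapM mphi _ lW lK); last by move=> z; exact: f1.
pose H (z : R * R) := f z.1 * (fejer_kernel k z.2 * wave g th (z.1 + - (6 / pi) * z.2)).
have fst_snd t x : t + - (6 / pi) * x = t - 6 / pi * x by rewrite mulNr.
have E1 x : fejer_kernel k x * \int[mu]_t (phi (t, x) * wave g th t) =
    \int[mu]_t H (t, x).
  rewrite /phi/= (Rint_translate _ cf f1 lW) -RintZ; last first.
    by apply: (L1M_bounded mf f1); exact: L1_shift.
  by apply: eq_Rint => t; rewrite /H/= fst_snd; ring.
under eq_Rint do rewrite E1.
have mH : measurable_fun [set: R * R] H.
  apply: measurable_funM; first by apply: measurableT_comp => //; exact: measurable_fst.
  apply: measurable_funM.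
    by apply: measurableT_comp; [exact: L1_measurable|exact: measurable_snd].
  by apply: measurableT_comp => //; exact: L1_measurable.
have lH2 x : L1 (fun t => H (t, x)).
  apply: (@L1M_bounded _ 1 f
    (fun t => fejer_kernel k x * wave g th (t + - (6 / pi) * x))) => //.
  exact/L1Z/L1_shift.
have lKW t : L1 (fun x => fejer_kernel k x * wave g th (t + - (6 / pi) * x)).
  rewrite (_ : (fun _ => _) = (fun x => wave g th (t + - (6 / pi) * x) * fejer_kernel k x)).
    apply: (@L1M_bounded _ (\int[mu]_x `|g x|)) => //.
    + apply: measurableT_comp; first exact: L1_measurable.
      by apply: measurable_funD => //; exact: measurable_funM.
    + by move=> x; exact: wave_le.
  by apply/funext => x; rewrite mulrC.
have lH1 t : L1 (fun x => H (t, x)) by exact: (L1Z (f t) (lKW t)).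
rewrite -(Rint_swap mH (b := fun x => \int[mu]_t `|wave g th t| * `|fejer_kernel k x|) _ lH1 lH2).
- rewrite (_ : \int[mu]_t _ = 0) ?mulr0// -[RHS](Rint_zero R); apply: eq_Rint => t.
  rewrite /H/= RintZ//.
  under eq_Rint do rewrite fst_snd.
  by rewrite Rint_fejer_kernel_wave// mulr0.
- by apply/L1Z/L1_norm.
- move=> x; rewrite mulrC -RintZ; last exact: L1_norm.
  pose G t := `|fejer_kernel k x| * `|wave g th t|.
  have lG : L1 G by exact/L1Z/L1_norm.
  rewrite -[leRHS](Rint_shift (- (6 / pi) * x) lG).
  apply: le_Rintegral => //; first exact: L1_norm.
    exact: L1_shift.
  by move=> t _; rewrite /H /G/= normrM (normrM (fejer_kernel k x)) ler_piMl ?mulr_ge0.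
Qed.

Lemma band_space_smear I k f : continuous f -> (forall x, `|f x| <= 1) ->
  (forall x, ~ I x -> 1 <= `|6 * x + k%:R| /\ 1 <= `|6 * x - k%:R|) ->
  band_space I (smear k f).
Proof.
move=> cf f1 Ik; apply/band_spaceP; split.
- exact: continuous_smear.
- by move=> t; exact: smear_le1.
move=> g [sg dg] th; apply: Rint_smear_wave => // x gx; apply: Ik => Ix.
suff : set0 x by [].
by rewrite -dg; split => //; apply: subset_closure.
Qed.

Lemma band_space0 I : band_space I (fun=> 0 : R).
Proof.
apply/band_spaceP; split.
- exact: cst_continuous.
- by move=> t; rewrite normr0.
- by move=> g _ th; rewrite -[RHS](Rint_zero R); apply: eq_Rint => t; rewrite mul0r.
Qed.

Lemma bounded_band_band n : bounded_band (@band R n).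
Proof.
exists (n%:R / 3 + 1 / 2) => [|x]; first by rewrite ltr_wpDl// divr_ge0.
have n0 : 0 <= n%:R / 3 :> R by rewrite divr_ge0.
by rewrite ler_norml => -[] /=; rewrite in_itv/= => /andP[? ?]; apply/andP; split; lra.
Qed.

Lemma notin_band_far k x : ~ band (k.-1)./2 x ->
  1 <= `|6 * x + k%:R| /\ 1 <= `|6 * x - k%:R|.
Proof.
rewrite /band => nb; set n := (k.-1)./2 in nb.
have n0 : 0 <= n%:R :> R by [].
(* A positive [k] is [2 n + 1] or [2 n + 2]; for [k = 0] the truncated predecessor gives [n = 0],
   whose band contains the interval of radius 1/6 about 0. *)
have nk : (k%:R = 0 :> R /\ n%:R = 0 :> R) \/
    (2 * n%:R + 1 <= k%:R :> R /\ k%:R <= 2 * n%:R + 2 :> R).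
  rewrite /n; case: (k) => [|k']; [by left|right].
  have e := odd_double_half k'; rewrite /=; set m := k'./2 in e *.
  have -> : k'.+1%:R = (odd k')%:R + 2 * m%:R + 1 :> R.
    by rewrite -[in LHS]e -[in LHS]addn1 natrD natrD -mul2n natrM.
  by case: (odd k') => /=; split; lra.
split; rewrite leNgt; apply/negP; rewrite ltr_norml => /andP[h1 h2]; apply: nb.
  case: nk => -[k1 k2].
    have [x0|x0] := lerP 0 x; [right|left]; rewrite /= in_itv/=; lra.
  by left; rewrite /= in_itv/=; lra.
case: nk => -[k1 k2].
  have [x0|x0] := lerP 0 x; [right|left]; rewrite /= in_itv/=; lra.
by right; rewrite /= in_itv/=; lra.
Qed.

Lemma smear_separation (f1 f2 : R -> R) : continuous f1 -> continuous f2 ->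
  (forall x, `|f1 x| <= 1) -> (forall x, `|f2 x| <= 1) ->
  (forall k, smear k f1 0 = smear k f2 0) -> f1 0 = f2 0.
Proof.
move=> c1 c2 b1 b2 E; apply/eqP; rewrite -subr_eq0; apply/eqP.
(* This is the difference in the rescaled variable of [smear] at time 0, so that equality of the
   smears becomes orthogonality to all modulated kernels. *)
pose u x := f1 (0 + 6 / pi * x) - f2 (0 + 6 / pi * x).
have cs f : continuous f -> continuous (fun x => f (0 + 6 / pi * x)).
  move=> cf x; apply: (@continuous_comp _ _ _ (fun x => 0 + 6 / pi * x) f); last exact: cf.
  by apply: cvgD; [exact: cvg_cst|apply: cvgM; [exact: cvg_cst|exact: cvg_id]].
have : u 0 = 0.
  apply: (@fejer_separation _ u 2).
  - by move=> x; apply: cvgB; exact: cs.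
  - move=> x; rewrite (le_trans (ler_normB _ _))//.
    by have := b1 (0 + 6 / pi * x); have := b2 (0 + 6 / pi * x); lra.
  - move=> k.
    have l f : continuous f -> (forall x, `|f x| <= 1) ->
        L1 (fun x => f (0 + 6 / pi * x) * fejer_kernel k x).
      move=> cf bf; apply: (@L1M_bounded _ 1) (L1_fejer_kernel k) => //.
      exact: measurable_shift_scale.
    have m0 : (fejer_mass R)^-1 != 0 by rewrite invr_eq0 gt_eqF// fejer_mass_gt0.
    have Ek := mulfI m0 (E k).
    transitivity (\int[mu]_x (f1 (0 + 6 / pi * x) * fejer_kernel k x -
                              f2 (0 + 6 / pi * x) * fejer_kernel k x)).
      by apply: eq_Rint => x; rewrite /u mulrBl.
    by rewrite RintB ?Ek ?subrr//; exact: l.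
by rewrite /u mulr0 addr0.
Qed.

End Smear.

(** * Compact metrizable spaces *)


Section Topology.
Variable R : realType.

Lemma cvg_initial (S : choiceType) (T : topologicalType) (f : S -> T)
    (F : set_system S) (s : S) : Filter F ->
  f @ F --> f s -> F --> (s : initial_topology f).
Proof.
move=> FF H A [_ [[B oB <-] Bfs] sBA]; apply: (filterS sBA).
by apply: H; exact: open_nbhs_nbhs.
Qed.

Lemma cvg_prod_topology (I : Type) (K : I -> topologicalType) (S : Type)
    (F : set_system S) (f : S -> prod_topology K) (g : prod_topology K) :
  Filter F -> (forall i, f s i @[s --> F] --> g i) -> f @ F --> g.
Proof.
move=> FF H; apply/cvg_sup => i.
by apply: (@cvg_initial _ _ (fun x : forall i, K i => x i)); exact: (H i).
Qed.

Lemma continuous_proj (I : Type) (K : I -> topologicalType) (i : I) :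
  continuous (fun x : prod_topology K => x i).
Proof.
move=> x A nA.
have /cvg_sup/(_ i) : x --> x by exact: cvg_id.
apply; exact: (@initial_continuous _ _ (fun x : forall i, K i => x i) x A nA).
Qed.

Lemma cvg_set_type (X : topologicalType) (A : set X) (S : Type)
    (F : set_system S) (f : S -> set_type A) (a : set_type A) : Filter F ->
  set_val (f s) @[s --> F] --> set_val a -> f @ F --> a.
Proof. by move=> FF H; apply: (@cvg_initial _ _ set_val); exact: H. Qed.

Lemma continuous_set_val (X : topologicalType) (A : set X) :
  continuous (set_val : set_type A -> X).
Proof. exact: initial_continuous. Qed.

Lemma compact_set_type (X : topologicalType) (A : set X) :
  compact A -> compact [set: set_type A].
Proof.
move=> cA F PF _.
have GA : (set_val @ F) A.
  suff -> : (set_val @ F) A = F setT by exact: filterT.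
  rewrite /fmap/=; congr F; apply/seteqP; split => // -[x xA] _.
  exact: (set_mem xA).
have [p [Ap clp]] := cA _ (fmap_proper_filter _ PF) GA.
exists (exist _ p (mem_set Ap)); split => // B N FB [_ [[U oU <-] Up] UN].
have [_ [[b Bb <-] Ub]] : (set_val @` B) `&` U !=set0.
  apply: clp; first by rewrite /fmap/=; apply: filterS FB; exact: preimage_image.
  exact: open_nbhs_nbhs.
by exists b; split => //; exact: UN.
Qed.

Lemma compact_embedding (Y X : topologicalType) (phi : Y -> X) :
  compact [set: Y] -> hausdorff_space X -> injective phi -> continuous phi ->
  homeomorphism_onto_image phi.
Proof.
move=> cY hX inj cphi; split => // U oU.
have cU : compact (phi @` ~` U).
  apply: continuous_compact; first exact: continuous_subspaceT.
  by apply: (subclosed_compact _ cY) => //; exact: open_closedC.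
exists (~` (phi @` ~` U)); first by apply: closed_openC; exact: compact_closed.
apply/seteqP; split => [_ [y Uy <-]|x [nx [y _ yx]]].
  by split; [move=> [z nUz /inj zy]; apply: nUz; rewrite zy | exists y].
exists y => //; apply: contrapT => nUy.
by apply: nx; exists y.
Qed.

(** * Metrizability from countably many separating functions *)

Section Separating.
Variables (X : topologicalType) (phi : nat -> X -> R).
Hypothesis phi_continuous : forall n, continuous (phi n).
Hypothesis phi_separating : forall x y, (forall n, phi n x = phi n y) -> x = y.

Lemma separating_hausdorff : hausdorff_space X.
Proof.
move=> p q pq; apply: phi_separating => n; apply/eqP/negPn/negP => npq.
have e0 : 0 < `|phi n p - phi n q| / 2 by rewrite divr_gt0// normr_gt0 subr_eq0.
have /cvgrPdist_lt/(_ _ e0) hp := @phi_continuous n p.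
have /cvgrPdist_lt/(_ _ e0) hq := @phi_continuous n q.
have [z [/= zp zq]] := pq _ _ hp hq.
have := ler_distD (phi n z) (phi n p) (phi n q).
by rewrite leNgt => /negP; apply; rewrite [X in _ < X]splitr ltrD// distrC.
Qed.

Hypothesis phi_bounded : forall n x, `|phi n x| <= 1.

(** The weights tend to 0 and the functions are bounded by 1, so only finitely many terms can exceed
    a given positive level. *)
Let term x y n : R := `|phi n x - phi n y| / n.+1%:R.

Definition separating_dist x y : R := sup (range (term x y)).

Let term_le2 x y n : term x y n <= 2.
Proof.
rewrite ler_pdivrMr ?ltr0n// (le_trans (ler_normB _ _))//.
have h1 := phi_bounded n x; have h2 := phi_bounded n y.
have h3 : 1 <= n.+1%:R :> R by rewrite ler1n.
by lra.
Qed.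

Let term_le x y n : term x y n <= separating_dist x y.
Proof.
apply: sup_upper_bound; last by exists n.
by split; [exists (term x y 0), 0%N|exists 2 => _ [m _ <-]; exact: term_le2].
Qed.

Let dist_le x y e : (forall n, term x y n <= e) -> separating_dist x y <= e.
Proof.
move=> H; apply: ge_sup; first by exists (term x y 0), 0%N.
by move=> _ [n _ <-].
Qed.

Let near_terms x (N : nat) (e : R) : 0 < e ->
  \forall y \near x, forall n, (n < N)%N -> `|phi n x - phi n y| < e.
Proof.
move=> e0; elim: N => [|N IH]; first by apply: nearW => y n; rewrite ltn0.
have /cvgrPdist_lt/(_ _ e0) hN := @phi_continuous N x.
near=> y => n; rewrite ltnS leq_eqVlt => /predU1P[->|nN].
  by near: y; exact: hN.
by move: n nN; near: y; exact: IH.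
Unshelve. all: by end_near. Qed.

(** Away from an open neighbourhood of [x] some term is locally bounded below, and compactness of
    the complement makes the bound uniform. Conversely, a ball contains the neighbourhood on which
    finitely many terms are small. *)
Lemma compact_separating_metrizable : compact [set: X] -> metrizable R X.
Proof.
move=> cX; exists separating_dist; split.
- move=> x y.
  have d0 : 0 <= separating_dist x y.
    by apply: (le_trans _ (term_le x y 0)); rewrite divr_ge0.
  split => //; split => [d|<-].
    apply: phi_separating => n; apply/eqP; rewrite -subr_eq0 -normr_le0.
    by have := term_le x y n; rewrite d ler_pdivrMr ?ltr0n// mul0r.
  apply/eqP; rewrite eq_le; apply/andP; split.
    by apply: dist_le => n; rewrite /term subrr normr0 mul0r.
  by apply: (le_trans _ (term_le x x 0)); rewrite divr_ge0.
- move=> x y; rewrite /separating_dist (_ : term x y = term y x)//.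
  by apply/funext => n; rewrite /term distrC.
- move=> x y z; apply: dist_le => n.
  apply: (le_trans _ (lerD (term_le x y n) (term_le y z n))).
  by rewrite -mulrDl ler_pM2r ?invr_gt0 ?ltr0n// ler_distD.
move=> x U; split.
  rewrite nbhsE => -[V [oV Vx] VU].
  have cV : compact (~` V).
    by apply: (subclosed_compact _ cX) => //; exact: open_closedC.
  have H : \forall e \near (0 : R)^'+, forall y, (~` V) y -> e <= separating_dist x y.
    apply: ((compact_near_coveringP (~` V)).1 cV _ _ (fun e y => e <= separating_dist x y)) => y nVy.
    have [n xy] : exists n, phi n x != phi n y.
      apply: contrapT => h; apply: nVy; suff <- : x = y by [].
      apply: phi_separating => n; apply/eqP; apply: contrapT => /negP hn.
      by apply: h; exists n.
    have e0 : 0 < `|phi n x - phi n y| / 2 by rewrite divr_gt0// normr_gt0 subr_eq0.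
    have /cvgrPdist_lt/(_ _ e0) hy := @phi_continuous n y.
    have e1 : 0 < `|phi n x - phi n y| / 2 / n.+1%:R by rewrite divr_gt0// ltr0n.
    near=> y' e => /=; apply: (le_trans _ (term_le x y' n)).
    apply: (@le_trans _ _ (`|phi n x - phi n y| / 2 / n.+1%:R)).
      by near: e; exact: nbhs_right_le.
    rewrite ler_pM2r ?invr_gt0 ?ltr0n//.
    have : `|phi n y - phi n y'| < `|phi n x - phi n y| / 2 by near: y'; exact: hy.
    have := ler_distD (phi n y') (phi n x) (phi n y).
    by rewrite (distrC (phi n y')); lra.
  have [e [He e0]] : exists e : R,
      (forall y, (~` V) y -> e <= separating_dist x y) /\ 0 < e.
    near (0 : R)^'+ => e; exists e; split; last by [].
    by near: e; exact: H.
  exists e => // y /= xy; apply: VU; apply: contrapT => nV.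
  by have := He y nV; rewrite leNgt xy.
move=> [e e0 eU]; have e2 : 0 < e / 2 by rewrite divr_gt0.
(* For [n >= N] a term is at most [2 / (n + 1)], hence at most [e / 2]. *)
pose N := (Num.truncn (4 / e)).+1.
apply: filterS (near_terms x N e2) => y Hy; apply: eU => /=.
apply: (@le_lt_trans _ _ (e / 2)); last by rewrite ltr_pdivrMr//; lra.
apply: dist_le => n; have n0 : 0 < n.+1%:R :> R by rewrite ltr0n.
rewrite /term ler_pdivrMr//; have n1 : 1 <= n.+1%:R :> R by rewrite ler1n.
have [nN|Nn] := ltnP n N.
  by rewrite (le_trans (ltW (Hy n nN)))// ler_peMr// ltW.
have : 4 / e <= n.+1%:R.
  by rewrite (le_trans (ltW (truncnS_gt _)))// ler_nat (leq_trans Nn).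
rewrite ler_pdivrMr// => h.
rewrite (le_trans (ler_normB _ _))//.
have h1 := phi_bounded n x; have h2 := phi_bounded n y.
by lra.
Unshelve. all: by end_near. Qed.

End Separating.

(** * Sequential continuity and observables on compact metric spaces *)

Section MetricFor.
Variables (Y : topologicalType) (d : Y -> Y -> R).
Hypothesis dP : metric_for d.

Lemma metric_for_near y (e : R) : 0 < e -> \forall z \near y, d y z < e.
Proof. by case: dP => _ _ _ H e0; apply/H; exists e. Qed.

(** Dominated convergence speaks of sequences; this turns its conclusion into continuity at a point
    of a metric space. *)
Lemma metric_for_continuous_seq (G : Y -> R) (y : Y) :
  (forall u : nat -> Y, u n @[n --> \oo] --> y -> G (u n) @[n --> \oo] --> G y) ->
  G z @[z --> y] --> G y.
Proof.
case: dP => dpos dC dtri dnbhs H; apply/cvgrPdist_lt => e e0.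
apply/dnbhs; apply: contrapT => nH.
have /choice[u hu] : forall n : nat, exists z, d y z < n.+1%:R^-1 /\ ~ `|G y - G z| < e.
  move=> n; apply: contrapT => hn; apply: nH; exists n.+1%:R^-1.
    by rewrite invr_gt0 ltr0n.
  by move=> z /= dz; apply: contrapT => hz; apply: hn; exists z.
have uy : u n @[n --> \oo] --> y.
  move=> A /dnbhs [r r0 rA].
  have := @cvg_harmonic R => /cvgrPdist_lt /(_ r r0); apply: filterS => n.
  rewrite sub0r normrN ger0_norm ?invr_ge0// => nr.
  by apply: rA => /=; have [h _] := hu n; exact: lt_trans h nr.
have /cvgrPdist_lt /(_ e e0) [N _ HN] := H u uy.
by have [_] := hu N; apply; exact: (HN N (leqnn N)).
Qed.

Lemma metric_for_dist_continuous q : continuous (d q).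
Proof.
case: dP => dpos dC dtri dnbhs y; apply/cvgrPdist_lt => e e0.
have := metric_for_near y e0; apply: filterS => z.
have h1 := dtri q y z; have h2 := dtri q z y.
by rewrite (dC z y) in h2 => h; rewrite ltr_norml; apply/andP; split; lra.
Qed.

Lemma metric_for_finite_net (r : R) : compact [set: Y] -> 0 < r ->
  exists s : seq Y, forall y, exists2 q, q \in s & d q y < r.
Proof.
move=> cY r0.
(* Eventually along this filter means for all lists containing a given finite one, so the
   near-covering form of compactness produces a finite net. *)
pose F := filter_from [set: seq Y] (fun s => [set s' : seq Y | {subset s <= s'}]).
have FF : Filter F.
  apply: filter_from_filter; first by exists [::].
  move=> s1 s2 _ _; exists (s1 ++ s2) => // s' /= ss.
  by split=> q qs; apply: ss; rewrite mem_cat qs ?orbT.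
have H : \forall s \near F, forall y, [set: Y] y -> exists2 q, q \in s & d q y < r.
  apply: ((compact_near_coveringP [set: Y]).1 cY _ F
    (fun s y => exists2 q, q \in s & d q y < r)) => y _.
  near=> z s; exists y => /=.
    near: s; exists [:: y] => // s /=; apply; exact: mem_head.
  by near: z; exact: metric_for_near.
have [s _ Hs] := H.
by exists s => y; exact: (Hs s (fun q qs => qs) y I).
Unshelve. all: by end_near. Qed.

(** The observables are distances, truncated at 1, to the points of [1 / (n + 1)]-nets, enumerated
    by pairs of a net and a position in it; codes of no such point give 0. *)
Lemma metric_for_separating : compact [set: Y] -> exists h : nat -> Y -> R,
  [/\ forall j, continuous (h j), forall j y, `|h j y| <= 1 &
      forall y z, (forall j, h j y = h j z) -> y = z].
Proof.
move=> cY; case: (dP) => dpos dC dtri dnbhs.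
have /choice[F HF] : forall n : nat, exists s : seq Y,
    forall y, exists2 q, q \in s & d q y < n.+1%:R^-1.
  by move=> n; apply: metric_for_finite_net => //; rewrite invr_gt0 ltr0n.
pose h (j : nat) (y : Y) : R := if @unpickle (nat * nat)%type j is Some (n, i) then
  if onth (F n) i is Some q then Num.min 1 (d q y) else 0 else 0.
exists h; split.
- move=> j y; rewrite /h; case: (unpickle j) => [[n i]|]; last exact: cvg_cst.
  case: (onth _ _) => [q|]; last exact: cvg_cst.
  by apply: (@continuous_min _ _ (cst 1) (d q));
    [exact: cst_continuous|exact: metric_for_dist_continuous].
- move=> j y; rewrite /h; case: (unpickle j) => [[n i]|]; last by rewrite normr0.
  case: (onth _ _) => [q|]; last by rewrite normr0.
  have [dq _] := dpos q y.
  by rewrite ger0_norm ?le_min ?ler01// ge_min lexx.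
move=> y z H; apply/(dpos y z).2/eqP/negPn/negP => dyz0.
have [dyz _] := dpos y z.
(* A net point within this radius of [y] is farther than the radius from [z]; the minimum with 1
   keeps the truncation from hiding the difference. *)
have r0 : 0 < Num.min 1 (d y z) / 2.
  by rewrite divr_gt0// lt_min ltr01 lt_neqAle dyz andbT eq_sym.
have [n _ hn] := near_infty_natSinv_lt (PosNum r0).
have {}hn := hn n (leqnn n); rewrite /= in hn.
have [q qF qy] := HF n y.
have := H (pickle (n, index q (F n))).
rewrite /h pickleK (_ : onth (F n) _ = Some q); last first.
  by rewrite onthE (nth_map q) ?index_mem// nth_index.
have hq := dtri y q z; rewrite (dC y q) in hq.
have m1 : Num.min 1 (d y z) <= 1 by rewrite ge_min lexx.
have m2 : Num.min 1 (d y z) <= d y z by rewrite ge_min lexx orbT.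
have qm := lt_trans qy hn; move: (Num.min 1 (d y z)) r0 m1 m2 qm => m r0 m1 m2 qm.
have -> : Num.min 1 (d q y) = d q y by apply/min_idPr; lra.
by move=> E; have : d q y < Num.min 1 (d q z); [rewrite lt_min; apply/andP; split; lra|rewrite E ltxx].
Qed.

End MetricFor.

End Topology.

(** * The universal flow *)


Section BandProduct.
Variable R : realType.
Implicit Types (I : set R) (m i : nat).

Lemma continuous_band_eval I (s : R) :
  continuous (fun f : set_type (band_space I) => set_val f s).
Proof.
move=> f.
have H : {family compact, set_val @ f --> set_val f} by exact: continuous_set_val.
have FF : Filter (set_val @ nbhs f) by exact: fmap_filter.
by have /pointwise_cvgP := pointwise_cvg_compact_family FF H; apply.
Qed.

(** On an equicontinuous set pointwise convergence is already uniform on compact sets, so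
    convergence in a factor can be checked one time at a time. *)
Lemma cvg_band_type I (S : Type) (F : set_system S)
    (h : S -> set_type (band_space I)) (l : set_type (band_space I)) :
  bounded_band I -> ProperFilter F ->
  (forall t, set_val (h s) t @[s --> F] --> set_val l t) -> h @ F --> l.
Proof.
move=> bI FF H; apply: cvg_set_type.
have PG : ProperFilter ((fun s => set_val (h s)) @ F) by exact: fmap_proper_filter.
have E : \forall W \near powerset_filter_from ((fun s => set_val (h s)) @ F),
    equicontinuous (W : set (R -> R)) id.
  apply/near_powerset_filter_fromP; first exact: equicontinuous_subset_id.
  exists (band_space I); last exact: band_space_equicontinuous.
  have Hs s : band_space I (set_val (h s)) by exact: set_valP.
  exact: (@filterE _ F _ _ Hs).
have [K _] := pointwise_compact_cvg (set_val l) PG E.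
by apply: K; apply/pointwise_cvgP.
Qed.

Definition translate_band I (t : R) (f : set_type (band_space I)) :
    set_type (band_space I) :=
  exist _ (translate t (set_val f))
    (mem_set (band_space_translate t (set_valP f))).

Definition translate_product (t : R) (x : band_product R) : band_product R :=
  fun m n => translate_band t (x m n).

(** Rational times suffice to separate points because the elements of the factors are continuous
    functions. *)
Definition band_coord (i : nat) (x : band_product R) : R :=
  if @unpickle ({m : nat & 'I_m.+1} * rat)%type i is Some (p, q) then
    set_val (x (tag p) (tagged p)) (ratr q)
  else 0.

Lemma continuous_band_product_coord m (n : 'I_m.+1) :
  continuous (fun x : band_product R => x m n).
Proof.
move=> x.
apply: (@continuous_comp _ _ _ (fun x : band_product R => x m)
  (fun y : prod_topology (fun n : 'I_m.+1 => set_type (band_space (@band R n))) => y n)).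
  exact: continuous_proj.
exact: continuous_proj.
Qed.

Lemma band_coord_continuous i : continuous (band_coord i).
Proof.
move=> x; rewrite /band_coord; case: (unpickle i) => [[p q]|]; last exact: cst_continuous.
apply: (@continuous_comp _ _ _ (fun x : band_product R => x (tag p) (tagged p))
  (fun f => set_val f (ratr q))).
  exact: continuous_band_product_coord.
exact: continuous_band_eval.
Qed.

Lemma band_type_continuous I (f : set_type (band_space I)) : continuous (set_val f : R -> R).
Proof. by have /band_spaceP[] := set_valP f. Qed.

Lemma band_type_le1 I (f : set_type (band_space I)) t : `|set_val f t| <= 1.
Proof. by have /band_spaceP[_ + _] := set_valP f; exact. Qed.

Lemma continuous_eq_rat (f g : R -> R) : continuous f -> continuous g ->
  (forall q : rat, f (ratr q) = g (ratr q)) -> f = g.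
Proof.
move=> cf cg fg; apply/funext => x; apply/eqP; rewrite -subr_eq0.
apply/negPn/negP => fgx.
have cfg : continuous (fun y => f y - g y) by move=> y; apply: cvgB; [exact: cf|exact: cg].
have e0 : 0 < `|f x - g x| by rewrite normr_gt0.
have /cvgrPdist_lt/(_ _ e0) := cfg x.
move=> /nbhs_ballP [r /= r0 Hr].
have [z [/= xq [q _ qz]]] : (ball x r `&` range (@ratr R)) !=set0.
  apply: dense_rat; last exact: ball_open.
  by exists x; exact: ballxx.
by have := Hr _ xq; rewrite -qz fg subrr subr0 ltxx.
Qed.

Lemma band_coord_separating x y :
  (forall i, band_coord i x = band_coord i y) -> x = y.
Proof.
move=> H; apply: functional_extensionality_dep => m.
apply: functional_extensionality_dep => n; apply: val_inj.
apply: continuous_eq_rat; try exact: band_type_continuous.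
move=> q; have := H (pickle (Tagged (fun m => 'I_m.+1) n, q)).
by rewrite /band_coord pickleK.
Qed.

Lemma band_coord_le1 i x : `|band_coord i x| <= 1.
Proof.
rewrite /band_coord; case: (unpickle i) => [[p q]|]; last by rewrite normr0.
exact: band_type_le1.
Qed.

Lemma compact_band_product : compact [set: band_product R].
Proof.
pose K m : set (prod_topology (fun n : 'I_m.+1 => set_type (band_space (@band R n)))) := setT.
have cK m : compact (K m).
  have := @tychonoff 'I_m.+1 (fun n => set_type (band_space (@band R n))) (fun=> setT) _.
  rewrite (_ : [set f | _] = K m).
    by apply => n; apply: compact_set_type; apply: compact_band_space; exact: bounded_band_band.
  by apply/seteqP; split.
have := @tychonoff nat _ K cK.
by rewrite (_ : [set f | _] = [set: band_product R]) //; apply/seteqP; split.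
Qed.

Lemma metrizable_band_product : metrizable R (band_product R).
Proof.
apply: (compact_separating_metrizable band_coord_continuous band_coord_separating).
  exact: band_coord_le1.
exact: compact_band_product.
Qed.

Lemma hausdorff_band_product : hausdorff_space (band_product R).
Proof. exact: (separating_hausdorff band_coord_continuous band_coord_separating). Qed.

(** The change of time is controlled uniformly over the band space by equicontinuity, and the change
    of point at a fixed time by continuity of evaluation. *)
Lemma continuous_translate_product :
  continuous (fun p : R * band_product R => translate_product p.1 p.2).
Proof.
move=> [t x]; apply: cvg_prod_topology => m; apply: cvg_prod_topology => n.
have bI := @bounded_band_band R n.
apply: cvg_band_type => // s /=; rewrite /translate.
have cx : (fun p : R * band_product R => set_val (p.2 m n) (s + t)) @ (t, x) -->
    set_val (x m n) (s + t).
  have ce : continuous (fun x : band_product R => set_val (x m n) (s + t)).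
    move=> z; apply: (@continuous_comp _ _ _ (fun x : band_product R => x m n)
      (fun f => set_val f (s + t))).
      exact: continuous_band_product_coord.
    exact: continuous_band_eval.
  exact: (@cvg_comp _ _ _ (fun p : R * band_product R => p.2)
    (fun x => set_val (x m n) (s + t)) (nbhs (t, x)) (nbhs x) _ cvg_snd (ce x)).
apply/cvgrPdist_lt => e e0; have e2 : 0 < e / 2 by rewrite divr_gt0.
have e4 : 0 < e / 4 by rewrite divr_gt0.
have H1 : \forall p \near (t, x), forall f, band_space (@band R n) f ->
    `|f (s + t) - f (s + p.1)| <= e / 4.
  have c1 : (fun p : R * band_product R => s + p.1) @ (t, x) --> s + t.
    by apply: cvgD; [exact: cvg_cst|exact: cvg_fst].
  exact: (c1 _ (band_space_near (s + t) bI e4)).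
have H2 := (cvgrPdist_lt _ _).1 cx _ e2.
near=> p.
have h1 : `|set_val (p.2 m n) (s + t) - set_val (p.2 m n) (s + p.1)| <= e / 4.
  by near: p; apply: filterS H1 => p; apply; exact: set_valP.
have h2 : `|set_val (x m n) (s + t) - set_val (p.2 m n) (s + t)| < e / 2.
  by near: p; exact: H2.
have := ler_distD (set_val (p.2 m n) (s + t)) (set_val (x m n) (s + t))
  (set_val (p.2 m n) (s + p.1)).
by move=> /le_lt_trans; apply; lra.
Unshelve. all: by end_near. Qed.

Lemma translate_product_flow : real_flow translate_product.
Proof.
split.
- exact: compact_band_product.
- exact: metrizable_band_product.
- exact: continuous_translate_product.
- move=> x; apply: functional_extensionality_dep => m.
  apply: functional_extensionality_dep => n; apply: val_inj.
  by apply/funext => s; rewrite /= /translate addr0.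
- move=> r s x; apply: functional_extensionality_dep => m.
  apply: functional_extensionality_dep => n; apply: val_inj.
  by apply/funext => t; rewrite /= /translate; congr (set_val (x m n) _); ring.
Qed.

End BandProduct.

(** * The embedding of an arbitrary flow *)

Section Embedding.
Variable R : realType.
Variables (Y : topologicalType) (S : R -> Y -> Y).
Hypothesis flowS : real_flow S.
Variable h : nat -> Y -> R.
Hypothesis h_continuous : forall j, continuous (h j).
Hypothesis h_le1 : forall j y, `|h j y| <= 1.

Definition orbit j y (t : R) : R := h j (S t y).

Lemma continuous_orbit j y : continuous (orbit j y).
Proof.
move=> t; apply: (@continuous_comp _ _ _ (fun t => S t y) (h j)); last exact: h_continuous.
have cS := real_flow_continuous flowS.
apply: (@continuous_comp _ _ _ (fun t : R => (t, y)) (fun p : R * Y => S p.1 p.2)); last exact: cS.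
move=> A [[B C] [/= tB yC] BCA]; apply: filterS tB => s Bs; apply: BCA.
by split => //=; exact: nbhs_singleton.
Qed.

Lemma continuous_orbit_point j t : continuous (fun y => orbit j y t).
Proof.
move=> y; apply: (@continuous_comp _ _ _ (fun y => S t y) (h j)); last exact: h_continuous.
have cS := real_flow_continuous flowS.
apply: (@continuous_comp _ _ _ (fun y : Y => (t, y)) (fun p : R * Y => S p.1 p.2)); last exact: cS.
move=> A [[B C] [/= tB yC] BCA]; apply: filterS yC => z Cz; apply: BCA.
by split => //=; exact: nbhs_singleton.
Qed.

(* Row [m] is decoded as [m.+1 = 2 ^ j * (2 * k + 1)]; since [k <= m], it has a
   factor of index [k.-1./2], the band containing the frequencies of
   [fejer_kernel k]. *)
Definition row_obs (m : nat) : nat := logn 2 m.+1.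
Definition row_freq (m : nat) : nat := (m.+1 %/ 2 ^ row_obs m)./2.

Definition coord_fun (m n : nat) y : R -> R :=
  if n == (row_freq m).-1./2 then smear (row_freq m) (orbit (row_obs m) y)
  else fun=> 0.

Lemma band_space_coord_fun m n y : band_space (@band R n) (coord_fun m n y).
Proof.
rewrite /coord_fun; case: eqP => [->|_]; last exact: band_space0.
apply: band_space_smear.
- exact: continuous_orbit.
- by move=> t; exact: h_le1.
- by move=> x; exact: notin_band_far.
Qed.

Definition embedding y : band_product R :=
  fun m n => exist _ (coord_fun m n y) (mem_set (band_space_coord_fun m n y)).

Lemma smear_translate k (f : R -> R) t : smear k (translate t f) = translate t (smear k f).
Proof.
apply/funext => s; rewrite /translate /smear; congr (_ * _); apply: eq_Rint => x.
by congr (f _ * _); ring.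
Qed.

Lemma embedding_equivariant t y :
  embedding (S t y) = translate_product t (embedding y).
Proof.
apply: functional_extensionality_dep => m.
apply: functional_extensionality_dep => n; apply: val_inj.
change (coord_fun m n (S t y) = translate t (coord_fun m n y)).
rewrite /coord_fun; case: eqP => _ //; rewrite -smear_translate; congr smear.
by apply/funext => s; rewrite /orbit /translate -(real_flowD flowS).
Qed.

Lemma row_surjective j k : exists2 m, row_obs m = j & row_freq m = k.
Proof.
have p0 : (0 < 2 ^ j * (2 * k + 1))%N by rewrite muln_gt0 expn_gt0 addn1.
exists (2 ^ j * (2 * k + 1)).-1; rewrite /row_freq /row_obs prednK//.
  rewrite lognM ?expn_gt0 ?addn1// pfactorK// [X in (_ + X)%N]logn_coprime ?addn0//.
  by rewrite coprime2n /= mul2n odd_double.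
rewrite lognM ?expn_gt0 ?addn1// pfactorK// [X in (_ + X)%N]logn_coprime; last first.
  by rewrite coprime2n /= mul2n odd_double.
by rewrite addn0 mulKn ?expn_gt0// /= mul2n uphalf_double.
Qed.

Lemma row_freq_le m : ((row_freq m).-1./2 < m.+1)%N.
Proof.
have h1 : (m.+1 %/ 2 ^ row_obs m <= m.+1)%N by exact: leq_div.
rewrite /row_freq; move: (_ %/ _)%N h1 => q h1.
lia.
Qed.

(** Equal images have equal smears for every observable and frequency, since each pair owns a row
    with a factor of the right index. Smears at time 0 determine the orbit function at time 0, which
    is the observable itself. *)
Lemma embedding_injective :
  (forall y z, (forall j, h j y = h j z) -> y = z) -> injective embedding.
Proof.
move=> h_separating y z yz; apply: h_separating => j.
have o x : orbit j x 0 = h j x by rewrite /orbit (real_flow0 flowS).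
rewrite -(o y) -(o z); apply: smear_separation; try exact: continuous_orbit;
  try by move=> t; exact: h_le1.
move=> k; have [m mj mk] := row_surjective j k.
have : coord_fun m (row_freq m).-1./2 y = coord_fun m (row_freq m).-1./2 z.
  exact: (congr1 (fun x : band_product R => set_val (x m (Ordinal (row_freq_le m)))) yz).
by rewrite /coord_fun eqxx mj mk => ->.
Qed.

(** At a fixed time a coordinate is an integral against a fixed integrable kernel, and its integrand
    depends continuously on [y], so dominated convergence along sequences is enough. *)
Lemma continuous_embedding : continuous embedding.
Proof.
have [d dP] := real_flow_metrizable flowS.
move=> y; apply: cvg_prod_topology => m; apply: cvg_prod_topology => n.
apply: cvg_band_type; first exact: bounded_band_band.
move=> t; change (coord_fun m n z t @[z --> y] --> coord_fun m n y t).
rewrite /coord_fun; case: (_ == _); last exact: cvg_cst.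
apply: (metric_for_continuous_seq dP) => u uy.
apply: cvgM; first exact: cvg_cst.
apply: (@Rint_dominated_cvg _ _ _ (fun x => `|fejer_kernel (row_freq m) x|)).
- move=> i; apply: measurable_funM; first by apply: measurable_shift_scale; exact: continuous_orbit.
  exact: (L1_measurable (L1_fejer_kernel R (row_freq m))).
- move=> x; apply: cvgM; last exact: cvg_cst.
  have co : continuous (fun z => orbit (row_obs m) z (t + 6 / pi * x)).
    exact: continuous_orbit_point.
  move=> A /co; rewrite nbhs_simpl => yA; exact: (uy _ yA).
- exact/L1_norm/L1_fejer_kernel.
- by move=> i x; rewrite normrM ler_piMl// h_le1.
Qed.

End Embedding.

(* The translation on the product is the unique action T satisfying the first
   conjunct, whose existence amounts to the translation invariance of the
   factors. *)
Theorem theorem1p4 (R : realType) :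
  exists T : R -> band_product R -> band_product R,
    (forall (t : R) (x : band_product R) (m : nat) (n : 'I_m.+1),
       set_val (T t x m n) = translate t (set_val (x m n))) /\
    universal_flow T.
Proof.
exists (@translate_product R); split => //.
split; first exact: translate_product_flow.
move=> Y S flowS.
have [d dP] := real_flow_metrizable flowS.
have [h [hc h1 hs]] := metric_for_separating dP (real_flow_compact flowS).
exists (embedding flowS hc h1); last exact: embedding_equivariant.
apply: compact_embedding.
- exact: (real_flow_compact flowS).
- exact: hausdorff_band_product.
- exact: (embedding_injective hs).
- exact: continuous_embedding.
Qed.
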